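(* Let $\xi_t$ be the totally asymmetric coalescence process on $\mathbb{Z}$ with the fully packed initial condition $\xi_0(x)=1$ for all $x\in\mathbb{Z}$. Let $$E_0(t):=\max\{i\le0:\ \xi_t(i)=1,\ \xi_t(j)=0\ \text{for all } j \text{ with } i<j\le0\},$$ i.e. $E_0(t)$ is the right-most nonpositive occupied position at time $t$. Then, as $t\to\infty$, $-E_0(t)/\sqrt{t}$ converges in distribution to the probability measure on $\mathbb{R}$ with density $$\frac{1}{\sqrt{\pi}}\exp\left(-\frac{a^2}{4}\right)\mathbf{1}_{a\ge0}\,da .$$
   Context: Totally asymmetric coalescence process: states are maps $\xi:\mathbb{Z}\to\{0,1\}$ ($\xi(x)=1$ means that $x$ is occupied by a particle). Independently for each pair of neighboring positions $(x,x+1)$, with rate $1$, the pair of values $(\xi(x),\xi(x+1))$ is updated by $00\to00$, $10\to10$, $01\to10$, $11\to10$. That is, particles jump independently to the left by one with rate $1$ and coalesce into one particle whenever they are at the same position. *)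

(* Defs.v *)
From HB Require Import structures.
From mathcomp Require Import all_boot all_order all_algebra.
From mathcomp Require Import all_classical all_reals all_analysis.
From mathcomp Require Import measurable_realfun ring.

Set Implicit Arguments.
Unset Strict Implicit.
Unset Printing Implicit Defensive.

Import Order.TTheory GRing.Theory Num.Theory.
Import numFieldNormedType.Exports.

Local Open Scope classical_set_scope.
Local Open Scope ring_scope.

(* Mutual independence of a family of random variables with values in a
   countable (discrete) type, where every subset is measurable. *)
Definition mutually_independent (d : measure_display) (T : measurableType d)
    (R : realType) (P : probability T R) (I : eqType) (V : countType)
    (X : I -> T -> V) : Prop :=
  forall (s : seq I) (B : I -> set V), uniq s ->
    P (\big[setI/setT]_(i <- s) (X i @^-1` B i))
    = (\prod_(i <- s) P (X i @^-1` B i))%E.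

(* Time is a real number; only the values at times t >= 0 are constrained. *)
Definition poisson_process (d : measure_display) (T : measurableType d)
    (R : realType) (P : probability T R) (rate : R)
    (N : R -> {RV P >-> nat}) : Prop :=
  [/\ forall w, N 0 w = 0%N,
      forall (s t : R) w, 0 <= s <= t -> (N s w <= N t w)%N,
      forall (t : R) w, 0 <= t -> \forall u \near t^'+, N u w = N t w,
      forall (s t : R) (k : nat), 0 <= s < t ->
        P [set w | (N t w - N s w)%N = k]
        = (poisson_pmf (rate * (t - s)) k)%:E
    & forall (n : nat) (t : nat -> R), 0 <= t 0%N ->
        (forall i, t i <= t i.+1) ->
        mutually_independent P
          (fun (i : 'I_n) w => (N (t i.+1) w - N (t i) w)%N)].

Definition independent_processes (d : measure_display) (T : measurableType d)
    (R : realType) (P : probability T R) (I : eqType)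
    (N : I -> R -> {RV P >-> nat}) : Prop :=
  forall ts : seq R, (forall t, t \in ts -> 0 <= t) ->
    mutually_independent P (fun (x : I) w => [seq N x t w | t <- ts]).

Definition coalesce (p : bool * bool) : bool * bool :=
  match p with
  | (false, false) => (false, false)
  | (true, false) => (true, false)
  | (false, true) => (true, false)
  | (true, true) => (true, false)
  end.

Definition rings (R : realType) (N : R -> nat) (t : R) : Prop :=
  0 < t /\ \forall s \near t^'-, (N s < N t)%N.

(* Deterministic evolution: the clock N x is attached to the pair (x, x + 1).
   When it rings at time t, the values of the pair just before t (the left
   limits, attained at all s < t close to t) are updated by coalesce; the
   value at x is constant as long as neither clock x - 1 nor clock x rings. *)
Definition coalescence_path (R : realType) (N : int -> R -> nat)
    (xi0 : int -> bool) (xi : R -> int -> bool) : Prop :=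
  [/\ forall x, xi 0 x = xi0 x,
      forall (x : int) (t : R), rings (N x) t ->
        \forall s \near t^'-,
          (xi t x, xi t (x + 1)) = coalesce (xi s x, xi s (x + 1))
    & forall (x : int) (s t : R), 0 <= s <= t ->
        N (x - 1) s = N (x - 1) t -> N x s = N x t -> xi t x = xi s x].

(* The evolution rule is only required almost surely: two neighbouring clocks
   may ring simultaneously on a null set. *)
Definition coalescence_process (d : measure_display) (T : measurableType d)
    (R : realType) (P : probability T R) (N : int -> R -> {RV P >-> nat})
    (xi0 : int -> bool) (xi : R -> int -> {RV P >-> bool}) : Prop :=
  [/\ forall x, poisson_process 1 (N x),
      independent_processes N
    & {ae P, forall w, coalescence_path (fun x t => N x t w) xi0
                                        (fun t x => xi t x w)}].

Definition fully_packed : int -> bool := fun=> true.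

Definition is_rightmost_nonpos (eta : int -> bool) (i : int) : Prop :=
  [/\ i <= 0, eta i = true & forall j : int, i < j <= 0 -> eta j = false].

(* The set below has at most one element; the junk value 0 is taken when no
   nonpositive site is occupied, which has probability 0 for the fully packed
   initial condition. *)
Definition rightmost_nonpos (eta : int -> bool) : int :=
  xget 0 [set i | is_rightmost_nonpos eta i].

Definition rescaled_E0 (d : measure_display) (T : measurableType d)
    (R : realType) (P : probability T R) (xi : R -> int -> {RV P >-> bool})
    (t : R) : T -> R :=
  fun w => - (rightmost_nonpos (fun x => xi t x w))%:~R / Num.sqrt t.

Section rescaled_E0_measurable.
Context d (T : measurableType d) (R : realType) (P : probability T R).
Variables (xi : R -> int -> {RV P >-> bool}) (t : R).

Let E (i : int) : set T :=
  [set w | is_rightmost_nonpos (fun x => xi t x w) i].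

Let mxi (x : int) (b : bool) : measurable [set w | xi t x w = b].
Proof.
rewrite (_ : [set w | _] = xi t x @^-1` [set b])//.
by rewrite -[X in measurable X]setTI; exact: measurable_funP.
Qed.

Let mcap (F : int -> set T) : (forall i, measurable (F i)) ->
  measurable (\bigcap_(i in [set: int]) F i).
Proof.
move=> mF; rewrite -[X in measurable X]setCK setC_bigcap; apply: measurableC.
by apply: countable_bigcupT_measurable => // i; exact/measurableC/mF.
Qed.

Let mE i : measurable (E i).
Proof.
have [i0|i0] := boolP (i <= 0); last first.
  rewrite (_ : E i = set0)//; apply/seteqP; split => // w [].
  by rewrite (negbTE i0).
rewrite (_ : E i = [set w | xi t i w = true] `&`
    \bigcap_(j in [set: int])
      if i < j <= 0 then [set w | xi t j w = false] else setT).
  by apply: measurableI => //; apply: mcap => j; case: ifP.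
apply/seteqP; split => w /=.
  by move=> [_ h1 h2]; split=> // j _; case: ifP => // /h2.
by move=> [h1 h2]; split=> // j ij; have := h2 j I; rewrite ij.
Qed.

Let rightmostP w i : E i w -> rightmost_nonpos (fun x => xi t x w) = i.
Proof.
move=> Ei; rewrite /rightmost_nonpos; case: xgetP => [j _ /= [j0 j1 j2]|/(_ i)//].
case: Ei => i0 i1 i2; apply/eqP; rewrite eq_le; apply/andP; split.
  by rewrite leNgt; apply/negP => ij; move: j1; rewrite i2// ij j0.
by rewrite leNgt; apply/negP => ij; move: i1; rewrite j2// ij i0.
Qed.

Let rightmost_default w : (forall i, ~ E i w) ->
  rightmost_nonpos (fun x => xi t x w) = 0.
Proof.
by move=> h; rewrite /rightmost_nonpos; case: xgetP => // j _ /= /h.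
Qed.

Lemma measurable_rescaled_E0 : measurable_fun setT (rescaled_E0 xi t).
Proof.
move=> _ Y mY; rewrite setTI.
pose g (i : int) : R := - i%:~R / Num.sqrt t.
pose C (b : Prop) (A : set T) : set T := [set w | b /\ A w].
have mC b A : measurable A -> measurable (C b A).
  move=> mA; have [hb|hb] := pselect b.
    by rewrite (_ : C b A = A)//; apply/seteqP; split => w // [].
  by rewrite (_ : C b A = set0)//; apply/seteqP; split => w // [].
rewrite (_ : _ @^-1` _ = (\bigcup_(i in [set: int]) C (Y (g i)) (E i)) `|`
    C (Y (g 0)) (\bigcap_(i in [set: int]) ~` E i)).
  apply: measurableU.
    by apply: countable_bigcupT_measurable => // i; exact: mC.
  by apply: mC; apply: mcap => i; exact: measurableC.
apply/seteqP; split => w /=.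
  rewrite /rescaled_E0 => Yw.
  have [[i Ei]|h] := pselect (exists i, E i w).
    by left; exists i => //; split=> //; move: Yw; rewrite (rightmostP Ei).
  right; have h' i : ~ E i w by move=> Ei; apply: h; exists i.
  by split=> [|i _]; [move: Yw; rewrite rightmost_default|exact: h'].
move=> [[i _ [Yi Ei]]|[Y0 h]]; rewrite /rescaled_E0.
  by rewrite (rightmostP Ei).
by rewrite rightmost_default// => i; exact: h.
Qed.

HB.instance Definition _ :=
  isMeasurableFun.Build _ _ _ _ (rescaled_E0 xi t) measurable_rescaled_E0.

End rescaled_E0_measurable.

Definition half_gauss_pdf (R : realType) (a : R) : R :=
  (Num.sqrt pi)^-1 * expR (- (a ^+ 2 / 4)) * \1_`[0, +oo[ a.

Definition half_gauss_prob (R : realType) : set (measurableTypeR R) -> \bar R :=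
  fun V => (\int[lebesgue_measure]_(a in V) (half_gauss_pdf a)%:E)%E.

Section half_gauss_probability.
Variable R : realType.
Local Notation mu := (@lebesgue_measure R).
Local Notation pdf := (@half_gauss_pdf R).

Let s2 : R := Num.sqrt 2.

Let s2_neq0 : s2 != 0.
Proof. by rewrite gt_eqF// sqrtr_gt0. Qed.

Let pdfE a : pdf a = 2 * normal_pdf 0 s2 a * \1_`[0, +oo[ a.
Proof.
rewrite /half_gauss_pdf normal_pdfE// /normal_peak /normal_fun subr0.
have s2E : s2 ^+ 2 = 2 by rewrite sqr_sqrtr.
have -> : s2 ^+ 2 * pi *+ 2 = 2 ^+ 2 * pi by rewrite s2E; ring.
have -> : s2 ^+ 2 *+ 2 = 4 by rewrite s2E; ring.
rewrite sqrtrM ?sqr_ge0// sqrtr_sqr ger0_norm// invfM mulNr.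
by rewrite !mulrA divff ?pnatr_eq0// mul1r.
Qed.

Let pdf_ge0 a : 0 <= pdf a.
Proof. by rewrite pdfE !mulr_ge0 ?normal_pdf_ge0. Qed.

Let mpdf : measurable_fun setT pdf.
Proof.
rewrite (_ : pdf = fun a => 2 * normal_pdf 0 s2 a * \1_`[0, +oo[ a).
  apply: measurable_funM; last exact: measurable_indic.
  by apply: measurable_funM => //; exact: measurable_normal_pdf.
by apply/funext => a; exact: pdfE.
Qed.

Let half0 : half_gauss_prob (@set0 R) = 0%E.
Proof. by rewrite /half_gauss_prob integral_set0. Qed.

Let half_ge0 A : (0 <= half_gauss_prob (A : set R))%E.
Proof. by apply: integral_ge0 => a _; rewrite lee_fin. Qed.

Let integral_pdf : (\int[mu]_a (pdf a)%:E = 1)%E.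
Proof.
rewrite -(@integral_normal_pdf R 0 s2) [RHS]ge0_symfun_integralT//=; last 3 first.
- by move=> a; exact: normal_pdf_ge0.
- exact: continuous_normal_pdf.
- by move=> a /=; rewrite !normal_pdfE// /normal_fun !subr0 sqrrN.
rewrite (_ : [set x | _] = `[0, +oo[%classic); last first.
  by apply/seteqP; split => x/=; rewrite in_itv/= andbT.
rewrite -ge0_integralZl//=; first last.
- by move=> a _; rewrite lee_fin normal_pdf_ge0.
- by apply/measurable_EFinP/measurable_funTS; exact: measurable_normal_pdf.
rewrite [RHS]integral_mkcond; apply: eq_integral => a _.
rewrite patchE pdfE indicE; case: ifPn => _; last by rewrite mulr0.
by rewrite mulr1 EFinM.
Qed.

Let half_sigma_additive : semi_sigma_additive (@half_gauss_prob R).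
Proof.
move=> /= A mA tA mUA.
rewrite /half_gauss_prob/= ge0_integral_bigcup//=; last 2 first.
- by apply/measurable_EFinP; exact: measurable_funTS.
- by move=> a _; rewrite lee_fin.
apply: is_cvg_ereal_nneg_natsum_cond => n _ _.
by apply: integral_ge0 => /= a _; rewrite lee_fin.
Qed.

HB.instance Definition _ := isMeasure.Build _ _ _
  (@half_gauss_prob R) half0 half_ge0 half_sigma_additive.

Let half_setT : half_gauss_prob [set: R] = 1%E.
Proof. exact: integral_pdf. Qed.

HB.instance Definition _ :=
  @Measure_isProbability.Build _ _ R (@half_gauss_prob R) half_setT.

End half_gauss_probability.

(* Convergence in distribution as t --> +oo of real random variables to a
   probability measure: the distribution functions converge at every
   continuity point of the limiting distribution function. *)
Definition cvg_in_distribution (d : measure_display) (T : measurableType d)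
    (R : realType) (P : probability T R) (X : R -> {RV P >-> R})
    (mu : probability (measurableTypeR R) R) : Prop :=
  forall a : R, {for a, continuous (fun b : R => mu `]-oo, b]%classic)} ->
    cdf (X t) a @[t --> +oo] --> mu `]-oo, a]%classic.

(* Main.v *)
(* Looking backwards in time, the vacancy of (l, r] at time t is the vacancy at
   time 0 of (l', r'], where l and r are moved one step to the right at each
   ring of the clock attached to their current position.  The two dual walkers
   are independent until they meet and coalesce, and for the fully packed
   initial condition the interval is vacant at time t iff they have met.

   Time is cut into M steps of length t / M.  Outside an event whose probability
   vanishes as M grows, each step contains at most one ring in a large box, and
   the dual pair becomes a pair of Bernoulli walkers.  Their meeting probability
   q_k(n) solves a monotone finite-difference scheme for the heat equation
   with boundary value 1 at n = 0.  The self-similar solution G(x / sqrt s) of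
   the heat equation, with G the tail function of the limit law, is turned into
   a super- and a subsolution of the scheme by shifting time by K = eta^4 t and
   space by A = eta sqrt t; letting t go to infinity and then eta to 0 gives
   P(vacant) --> G(a), so no central limit theorem is needed. *)

Require Import Defs.
From HB Require Import structures.
From mathcomp Require Import all_boot all_order all_algebra.
From mathcomp Require Import all_classical all_reals all_analysis.
From mathcomp Require Import measurable_realfun ring lra zify.

Set Implicit Arguments.
Unset Strict Implicit.
Unset Printing Implicit Defensive.

Import Order.TTheory GRing.Theory Num.Theory.
Import numFieldNormedType.Exports.

Local Open Scope classical_set_scope.
Local Open Scope ring_scope.

(** * The heat kernel *)

Section heat_kernel.
Variable R : realType.
Implicit Types x y h s sigma : R.

Lemma MVT_abs_le (f df : R -> R) (C a b : R) : a <= b ->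
  (forall x, is_derive x 1 f (df x)) ->
  (forall x, a <= x <= b -> `|df x| <= C) ->
  `|f b - f a| <= C * (b - a).
Proof.
move=> ab dfx Cf.
have cf : {within `[a, b], continuous f}.
  by apply: derivable_within_continuous => x _; have [] := dfx x.
have [c cab ->] := MVT_segment ab (fun x _ => dfx x) cf.
rewrite normrM (ger0_norm (_ : 0 <= b - a)) ?subr_ge0//.
by rewrite ler_wpM2r ?subr_ge0// Cf.
Qed.

Definition gauss y : R := (Num.sqrt pi)^-1 * expR (- (y ^+ 2 / 4)).

Lemma gauss_ge0 y : 0 <= gauss y.
Proof. by rewrite mulr_ge0 ?expR_ge0// invr_ge0 sqrtr_ge0. Qed.

(** With z = y^2 / 4, the exponential series gives z^n / n! <= exp z, and the prefactor 1 / sqrt pi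
    is at most 1. These bounds absorb the powers of [y] in the remainders below. *)
Lemma gauss_moment n y : y ^+ (2 * n) * gauss y <= 4 ^+ n * n`!%:R.
Proof.
have y4 : 0 <= y ^+ 2 / 4 by rewrite divr_ge0 ?sqr_ge0.
have pi1 : (Num.sqrt pi : R)^-1 <= 1.
  rewrite invf_le1 ?sqrtr_gt0 ?pi_gt0//.
  by rewrite -[leLHS]sqrtr1 ler_wsqrtr//; have := pi_ge2 R; lra.
have e : (y ^+ 2 / 4) ^+ n * expR (- (y ^+ 2 / 4)) <= n`!%:R.
  rewrite expRN ler_pdivrMr ?expR_gt0//.
  rewrite -ler_pdivrMl ?ltr0n ?fact_gt0// [leLHS]mulrC.
  case: n => [|n].
    by rewrite expr0 fact0 divr1; have := expR_ge1Dx (y ^+ 2 / 4); lra.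
  by apply: le_trans (expR_ge1Dxn n y4); rewrite lerDr.
have -> : y ^+ (2 * n) * gauss y = 4 ^+ n *
    ((Num.sqrt pi)^-1 * ((y ^+ 2 / 4) ^+ n * expR (- (y ^+ 2 / 4)))).
  rewrite /gauss exprM expr_div_n; field.
  by rewrite sqrtr_eq0 -ltNge pi_gt0 expf_neq0.
rewrite ler_wpM2l ?exprn_ge0//.
apply: le_trans e; rewrite ler_piMl// mulr_ge0 ?exprn_ge0 ?expR_ge0//.
Qed.

Lemma gauss_le1 y : gauss y <= 1.
Proof. by have := @gauss_moment 0 y; rewrite muln0 !expr0 !mul1r. Qed.

Lemma gauss_moment2 y : y ^+ 2 * gauss y <= 4.
Proof. by have := @gauss_moment 1 y; rewrite muln1 expr1 factS fact0 mulr1. Qed.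

Lemma gauss_moment4 y : y ^+ 4 * gauss y <= 32.
Proof. by have := @gauss_moment 2 y; rewrite !factS fact0; lra. Qed.

Definition dgauss y : R := - (y / 2) * gauss y.

Lemma is_derive_gauss y : is_derive y 1 gauss (dgauss y).
Proof.
pose q : R -> R := fun z => - (z ^+ 2 / 4).
have dq : is_derive y 1 q (- (y / 2)).
  have -> : q = - ((4^-1 : R) *: (@id R) ^+ 2).
    by apply/funext => z; rewrite /q !fctE/=; rewrite /GRing.scale/= mulrC.
  by apply: is_derive_eq; rewrite /GRing.scale/= expr1 mulr1; field.
have -> : gauss = (Num.sqrt pi : R)^-1 *: (expR \o q).
  by apply/funext.
by apply: is_derive_eq; rewrite /GRing.scale/= /dgauss /gauss /q; ring.
Qed.

Definition ddgauss y : R := (y ^+ 2 / 4 - 2^-1) * gauss y.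

Lemma is_derive_dgauss y : is_derive y 1 dgauss (ddgauss y).
Proof.
have -> : dgauss = ((- 2^-1 : R) *: (@id R)) * gauss.
  by apply/funext => z; rewrite /dgauss !fctE /GRing.scale/=; ring.
have := is_derive_gauss y => ?.
apply: is_derive_eq.
have -> : ddgauss y = - 2^-1 * y * dgauss y + gauss y * (- 2^-1 * 1).
  by rewrite /ddgauss /dgauss; field.
by [].
Qed.

Lemma ddgauss_bound y : `|ddgauss y| <= 3 / 2.
Proof.
have := gauss_moment2 y; have := gauss_le1 y; have := gauss_ge0 y.
rewrite /ddgauss ler_norml; have := sqr_ge0 y.
move: (gauss y) (y ^+ 2) => g z *; apply/andP; split; nra.
Qed.

Variable G : R -> R.
Hypothesis dG : forall y, is_derive y 1 G (- gauss y).

(** A Taylor expansion: [G] has second derivative [- dgauss], and its third derivative is bounded,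
    which makes the remainder cubic. *)
Lemma second_difference y h : 0 <= h ->
  `|G (y + h) + G (y - h) - 2 * G y + h ^+ 2 * dgauss y| <= 3 * h ^+ 3.
Proof.
move=> h0.
(* Up to sign, this is the derivative in [u] of the quantity to bound, which vanishes at [u = 0];
   the mean value theorem on [0, h] then supplies the third factor [h]. *)
have gy (u : R) : 0 <= u -> `|gauss (y + u) - gauss (y - u) - 2 * u * dgauss y| <=
    3 * u ^+ 2.
  move=> u0.
  have cg : {within `[y - u, y + u], continuous gauss}.
    by apply: derivable_within_continuous => x _; have [] := is_derive_gauss x.
  have yu : y - u <= y + u by lra.
  have [z zab E] := MVT_segment yu (fun x _ => is_derive_gauss x) cg.
  have -> : gauss (y + u) - gauss (y - u) - 2 * u * dgauss y =
    2 * u * (dgauss z - dgauss y) by rewrite E; ring.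
  have zu : `|dgauss z - dgauss y| <= 3 / 2 * u.
    move: zab; rewrite in_itv/= => /andP[z1 z2].
    have [yz|zy] := leP y z.
      apply: (le_trans (MVT_abs_le yz is_derive_dgauss
        (fun x _ => ddgauss_bound x))); lra.
    rewrite distrC.
    apply: (le_trans (MVT_abs_le (ltW zy) is_derive_dgauss
        (fun x _ => ddgauss_bound x))); lra.
  rewrite normrM ger0_norm ?mulr_ge0//; nra.
pose f u : R := G (y + u) + G (y - u) - 2 * G y + u ^+ 2 * dgauss y.
pose df u : R := - (gauss (y + u) - gauss (y - u) - 2 * u * dgauss y).
have fdf (u : R) : is_derive u 1 f (df u).
  have d1 : is_derive u 1 (fun u : R => G (y + u)) (- gauss (y + u)).
    have ? : is_derive (y + u) 1 G (- gauss (y + u)) by [].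
    have ? : is_derive u 1 (fun u : R => y + u) (1 : R).
      rewrite (_ : (fun _ => _) = cst y + (@id R))//.
      by apply: is_derive_eq; rewrite add0r.
    rewrite (_ : (fun u => _) = G \o (fun u : R => y + u))//.
    by apply: is_derive_eq; exact: mulr1.
  have d2 : is_derive u 1 (fun u : R => G (y - u)) (gauss (y - u)).
    have ? : is_derive (y - u) 1 G (- gauss (y - u)) by [].
    have ? : is_derive u 1 (fun u : R => y - u) (- 1 : R).
      rewrite (_ : (fun _ => _) = cst y - (@id R))//.
      by apply: is_derive_eq; rewrite add0r.
    rewrite (_ : (fun u => _) = G \o (fun u : R => y - u))//.
    by apply: is_derive_eq; exact: etrans (mulrNN _ _) (mulr1 _).
  have -> : f = (fun u : R => G (y + u)) + (fun u : R => G (y - u)) - cst (2 * G y) +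
     dgauss y *: (@id R) ^+ 2.
    by apply/funext => v; rewrite /f !fctE /GRing.scale/= [_ * dgauss y]mulrC.
  have d3 : is_derive u 1 (dgauss y *: (@id R) ^+ 2) (dgauss y * (2 * u)).
    by apply: is_derive_eq; rewrite /GRing.scale/= expr1 mulr1.
  have d4 := is_deriveD (is_deriveB (is_deriveD d1 d2)
    (is_derive_cst (2 * G y) u 1)) d3.
  apply: (is_derive_eq d4); rewrite /df subr0.
  by move: (gauss _) (gauss _) (dgauss _) => *; ring.
have := @MVT_abs_le f df (3 * h ^+ 2) 0 h h0 (fdf).
have -> : f 0 = 0 by rewrite /f addr0 subr0; ring.
rewrite !subr0 -mulrA -exprSr; apply=> u /andP[u0 uh].
rewrite /df normrN; apply: (le_trans (gy _ u0)).
by rewrite ler_wpM2l// lerXn2r// nnegrE.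
Qed.

(* With [y = x / sqrt s] and [e = sigma / s], [rho * y] is
   [x / sqrt (s + sigma)]. *)
Lemma time_difference y (rho e : R) : 0 <= y -> 0 < rho <= 1 ->
  rho ^+ 2 * (1 + e) = 1 -> 0 <= e <= 4^-1 ->
  `|G (rho * y) - G y + e * dgauss y| <= 6 * e ^+ 2.
Proof.
move=> y0 /andP[rho0 rho1] rhoe /andP[e0 e4].
(* The next two bounds express that rho, the inverse square root of 1 + e, is 1 - e / 2 + O(e^2);
   each is checked by comparing squares. *)
have rho_lb : 1 - rho <= e / 2.
  rewrite leNgt; apply/negP => H.
  have : rho ^+ 2 < (1 - e / 2) ^+ 2 by rewrite ltrXn2r// ?nnegrE//; lra.
  by nra.
have rho_ub : e / 2 - e ^+ 2 <= 1 - rho.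
  rewrite leNgt; apply/negP => H.
  have : (1 - e / 2 + e ^+ 2) ^+ 2 < rho ^+ 2.
    by rewrite ltrXn2r// ?nnegrE//; nra.
  by nra.
have cg : {within `[rho * y, y], continuous G}.
  by apply: derivable_within_continuous => x _; have [] := dG x.
have yu : rho * y <= y by rewrite ler_piMl.
have [z + E] := MVT_segment yu (fun x _ => dG x) cg.
rewrite in_itv/= => /andP[z1 z2].
have z0 : 0 <= z by apply: le_trans z1; rewrite mulr_ge0// ltW.
(* The increment of [G] is (1 - rho) y gauss(z) with z between rho y and y, while e dgauss(y) = - (e
   / 2) y gauss(y). Two errors of order e^2 remain: moving z to y, and replacing 1 - rho by e /
   2. *)
have -> : G (rho * y) - G y + e * dgauss y =
    (1 - rho) * y * (gauss z - gauss y) + (1 - rho - e / 2) * (y * gauss y).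
  have -> : G (rho * y) - G y = gauss z * (y - rho * y).
    by rewrite -[LHS]opprK opprB E mulNr opprK.
  by rewrite /dgauss; field.
have yg : `|y * gauss y| <= 3.
  rewrite ger0_norm ?mulr_ge0 ?gauss_ge0//.
  have := gauss_moment2 y; have := gauss_le1 y; have := gauss_ge0 y.
  by move: (gauss y) => g *; nra.
apply: le_trans (ler_normD _ _) _.
have second : `|(1 - rho - e / 2) * (y * gauss y)| <= 3 * e ^+ 2.
  rewrite normrM mulrC ler_pM//.
  by rewrite ler_norml; apply/andP; split; lra.
(* [y <= u / rho], so [y ^ 2 * |dgauss u|] is controlled by a moment at [u]. *)
have first : `|(1 - rho) * y * (gauss z - gauss y)| <= 3 * e ^+ 2.
  have cgg : {within `[z, y], continuous gauss}.
    by apply: derivable_within_continuous => x _; have [] := is_derive_gauss x.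
  have [u + Eu] := MVT_segment z2 (fun x _ => is_derive_gauss x) cgg.
  rewrite in_itv/= => /andP[u1 u2].
  have u0 : 0 <= u by exact: le_trans u1.
  have gu : u ^+ 3 * gauss u <= 18.
    have := gauss_moment2 u; have := gauss_moment4 u; have := gauss_ge0 u.
    have : u ^+ 3 <= (u ^+ 2 + u ^+ 4) / 2 by have := sqr_ge0 (u - u ^+ 2); nra.
    by move: (gauss u) (u ^+ 3) (u ^+ 2) (u ^+ 4) => g c a b *; nra.
  have yu2 : y ^+ 2 * `|dgauss u| <= 12.
    rewrite /dgauss normrM normrN !ger0_norm ?gauss_ge0 ?divr_ge0//.
    have : y ^+ 2 <= 5 / 4 * u ^+ 2.
      have ru : rho * y <= u by exact: le_trans u1.
      have : (rho * y) ^+ 2 <= u ^+ 2.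
        by rewrite lerXn2r// nnegrE// mulr_ge0// ltW.
      have -> : y ^+ 2 = (1 + e) * (rho * y) ^+ 2.
        by rewrite exprMn mulrA [_ * rho ^+ 2]mulrC rhoe mul1r.
      by have := sqr_ge0 u; move: (u ^+ 2) ((rho * y) ^+ 2) => a b *; nra.
    have ug : 0 <= u / 2 * gauss u by rewrite mulr_ge0 ?gauss_ge0 ?divr_ge0.
    move=> /(ler_wpM2r ug) H; apply: (le_trans H).
    rewrite [leLHS](_ : _ = 5 / 8 * (u ^+ 3 * gauss u)); last by field.
    by lra.
  rewrite -[gauss z - gauss y]opprB mulrN normrN Eu.
  rewrite normrM (normrM _ y) (normrM (dgauss u)) (ger0_norm y0)
    (@ger0_norm _ (1 - rho)) ?subr_ge0//
    (@ger0_norm _ (y - z)) ?subr_ge0//.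
  have yz : y - z <= (1 - rho) * y by lra.
  have rho10 : 0 <= 1 - rho by lra.
  apply: (@le_trans _ _ ((1 - rho) ^+ 2 * (y ^+ 2 * `|dgauss u|))).
    rewrite (_ : (1 - rho) ^+ 2 * _ =
      (1 - rho) * y * (`|dgauss u| * ((1 - rho) * y))); last by ring.
    by apply: ler_wpM2l; [exact: mulr_ge0|apply: ler_wpM2l].
  have : (1 - rho) ^+ 2 <= (e / 2) ^+ 2 by rewrite lerXn2r ?nnegrE// divr_ge0.
  have : 0 <= y ^+ 2 * `|dgauss u| by rewrite mulr_ge0 ?sqr_ge0.
  have := sqr_ge0 (1 - rho).
  move: yu2; move: (y ^+ 2 * _) ((1 - rho) ^+ 2) => a b *; nra.
rewrite (_ : 6 * e ^+ 2 = 3 * e ^+ 2 + 3 * e ^+ 2); last by ring.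
by rewrite lerD.
Qed.

(** Consistency of the scheme: G(x / sqrt s) solves u_s = u_xx. With h = 1 / sqrt s and e = sigma
    h^2, the time difference and sigma times the space difference share the main term - e dgauss(y),
    which cancels. Since h <= 1, the time error of order e^2 is also at most of order sigma h^3. *)
Lemma heat_step x sigma s : 0 <= x -> 0 <= sigma <= 4^-1 -> 1 <= s ->
  `|G (x / Num.sqrt (s + sigma)) - G (x / Num.sqrt s)
    - sigma * (G ((x + 1) / Num.sqrt s) + G ((x - 1) / Num.sqrt s)
               - 2 * G (x / Num.sqrt s))|
  <= 9 * sigma * (Num.sqrt s)^-1 ^+ 3.
Proof.
move=> x0 /andP[sg0 sg4] s1.
have s0 : 0 < s by lra.
set r := Num.sqrt s; have r0 : 0 < r by rewrite sqrtr_gt0.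
have r2 : r ^+ 2 = s by rewrite sqr_sqrtr// ltW.
have r1 : 1 <= r by rewrite -[leLHS]sqrtr1 ler_wsqrtr.
set q := Num.sqrt (s + sigma); have q0 : 0 < q by rewrite sqrtr_gt0; lra.
have q2 : q ^+ 2 = s + sigma by rewrite sqr_sqrtr; lra.
have rq : r <= q by rewrite ler_wsqrtr; lra.
pose y := x / r; pose h := r^-1.
have h0 : 0 <= h by rewrite invr_ge0 ltW.
have h1 : h <= 1 by rewrite invf_le1.
have e0 : 0 <= sigma * h ^+ 2 by rewrite mulr_ge0 ?exprn_ge0.
have h21 : h ^+ 2 <= 1 by rewrite exprn_ile1.
have T := @time_difference y (r / q) (sigma * h ^+ 2).
have S := @second_difference y h h0.
rewrite (_ : (x + 1) / r = y + h); last by rewrite mulrDl mul1r.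
rewrite (_ : (x - 1) / r = y - h); last by rewrite mulrBl mul1r.
rewrite -/y.
have -> : x / q = r / q * y by rewrite /y; field; rewrite !gt_eqF.
have {}T : `|G (r / q * y) - G y + sigma * h ^+ 2 * dgauss y| <=
    6 * (sigma * h ^+ 2) ^+ 2.
  apply: T.
  - by rewrite divr_ge0// ltW.
  - by rewrite divr_gt0//= ler_pdivrMr// mul1r.
  - rewrite /h !expr_div_n exprVn q2 r2; field.
    by rewrite !gt_eqF//; lra.
  - by rewrite e0/=; nra.
have -> : G (r / q * y) - G y - sigma * (G (y + h) + G (y - h) - 2 * G y) =
  (G (r / q * y) - G y + sigma * h ^+ 2 * dgauss y) -
  sigma * (G (y + h) + G (y - h) - 2 * G y + h ^+ 2 * dgauss y) by ring.
apply: le_trans (ler_normB _ _) _.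
rewrite normrM (ger0_norm sg0).
have -> : 9 * sigma * h ^+ 3 = 6 * sigma * h ^+ 3 + sigma * (3 * h ^+ 3) by ring.
apply: lerD; last exact: ler_wpM2l.
apply: (le_trans T).
have h3 : 0 <= h ^+ 3 by rewrite exprn_ge0.
have : (sigma * h ^+ 2) ^+ 2 <= sigma * h ^+ 3; last by lra.
rewrite (_ : (sigma * h ^+ 2) ^+ 2 = (sigma * h) * (sigma * h ^+ 3)); last by ring.
by rewrite ler_piMl ?mulr_ge0//; nra.
Qed.

End heat_kernel.

(** * The limit law *)

Section gauss_tail.
Variable R : realType.
Local Notation mu := (@lebesgue_measure R).

Lemma gauss_normalE (y : R) : gauss y = 2 * normal_pdf 0 (Num.sqrt 2) y.
Proof.
have s20 : Num.sqrt 2 != 0 :> R by rewrite gt_eqF// sqrtr_gt0.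
rewrite /gauss normal_pdfE// /normal_peak /normal_fun subr0.
have s2E : Num.sqrt 2 ^+ 2 = 2 :> R by rewrite sqr_sqrtr.
have -> : Num.sqrt 2 ^+ 2 * pi *+ 2 = 2 ^+ 2 * pi :> R by rewrite s2E; ring.
have -> : Num.sqrt 2 ^+ 2 *+ 2 = 4 :> R by rewrite s2E; ring.
rewrite sqrtrM ?sqr_ge0// sqrtr_sqr ger0_norm// invfM mulNr.
by rewrite !mulrA divff ?pnatr_eq0// mul1r.
Qed.

Lemma integrable_gauss (D : set R) : measurable D ->
  mu.-integrable D (EFin \o @gauss R).
Proof.
move=> mD; apply: (@integrableS _ _ _ mu setT) => //.
rewrite (_ : _ \o _ = fun y => (2%:E * (normal_pdf 0 (Num.sqrt 2) y)%:E)%E).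
  by apply: integrableZl => //; exact: integrable_normal_pdf.
by apply/funext => y /=; rewrite gauss_normalE.
Qed.

Lemma continuous_gauss : continuous (@gauss R).
Proof.
move=> y; apply: differentiable_continuous.
by apply/derivable1_diffP; have [] := is_derive_gauss y.
Qed.

Definition gauss_cdf (y : R) : R := (\int[mu]_(x in `]-oo, y]) gauss x)%R.

(** For [y >= 0] the bracket is the integral of [gauss] over [0, y], so this is the tail of the
    limit law. Writing it with [gauss_cdf] extends it smoothly to negative [y], so that
    differentiation needs no special case at 0. *)
Definition gauss_tail (y : R) : R :=
  1 - (gauss_cdf y - (\int[mu]_(x in `]-oo, 0[) gauss x)%R).

Lemma is_derive_gauss_tail (y : R) : is_derive y 1 gauss_tail (- gauss y).
Proof.
have y1 : y < y + 1 by rewrite ltrDl.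
have [h1 h2] : derivable gauss_cdf y 1 /\ (gauss_cdf^`())%classic y = gauss y.
  apply: (continuous_FTC1 (a := -oo%O) y1).
  - apply: integrable_gauss; exact: measurable_itv.
  - by rewrite ltNyr.
  - exact: continuous_gauss.
have d1 : is_derive y 1 gauss_cdf (gauss y).
  apply: (DeriveDef h1); rewrite -derive1E; exact: h2.
rewrite (_ : gauss_tail = cst 1 -
  (gauss_cdf - cst (\int[mu]_(x in `]-oo, 0[) gauss x)%R))//.
by apply: is_derive_eq; rewrite subr0 sub0r.
Qed.

Lemma half_gauss_pdf_lt0 (x : R) : x < 0 -> half_gauss_pdf x = 0.
Proof.
move=> x0; rewrite /half_gauss_pdf indicE memNset ?mulr0//=.
by rewrite in_itv/= leNgt x0.
Qed.

Lemma half_gauss_pdf_ge0E (x : R) : 0 <= x -> half_gauss_pdf x = gauss x.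
Proof.
move=> x0; rewrite /half_gauss_pdf indicE mem_set ?mulr1//=.
by rewrite in_itv/= x0.
Qed.

Lemma half_gauss_pdf_ge0 (x : R) : 0 <= half_gauss_pdf x.
Proof.
have [?|?] := ltP x 0; first by rewrite half_gauss_pdf_lt0.
by rewrite half_gauss_pdf_ge0E// gauss_ge0.
Qed.

Lemma measurable_half_gauss_pdf : measurable_fun setT (@half_gauss_pdf R).
Proof.
rewrite (_ : @half_gauss_pdf R = @gauss R \* \1_`[0, +oo[)//.
apply: measurable_funM; last exact: measurable_indic.
by apply/measurable_EFinP; have /integrableP[] := integrable_gauss measurableT.
Qed.

Lemma half_gauss_cdf (y : R) : 0 <= y ->
  half_gauss_prob `]-oo, y] = (1 - gauss_tail y)%:E.
Proof.
move=> y0.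
have mg D : measurable D -> measurable_fun D (EFin \o @gauss R).
  by move=> mD; have /integrableP[] := integrable_gauss mD.
have setE : `]-oo, y]%classic = `]-oo, 0[%classic `|` `[0, y]%classic :> set R.
  by rewrite -itv_bndbnd_setU// bnd_simp.
have disj : [disjoint `]-oo, 0[%classic & `[0, y]%classic :> set R].
  apply/disj_setPS => x [] /=; rewrite !in_itv/= => x0 /andP[].
  by rewrite leNgt x0.
have gcdf : (gauss_cdf y)%:E =
    (\int[mu]_(x in `]-oo, 0%R[) (gauss x)%:E +
     \int[mu]_(x in `[0%R, y]) (gauss x)%:E)%E.
  rewrite /gauss_cdf /Rintegral fineK; last first.
    by apply: integrable_fin_num => //; exact: integrable_gauss.
  rewrite setE ge0_integral_setU//; first by apply: mg; exact: measurableU.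
  by move=> x _; rewrite lee_fin gauss_ge0.
rewrite /gauss_tail opprB addrCA subrr addr0.
rewrite EFinB gcdf /Rintegral fineK; last first.
  by apply: integrable_fin_num => //; exact: integrable_gauss.
rewrite [X in (X - _)%E]addeC addeK; last first.
  by apply: integrable_fin_num => //; exact: integrable_gauss.
rewrite /half_gauss_prob setE.
rewrite ge0_integral_setU//.
- rewrite integral0_eq ?add0e; last first.
    by move=> x /=; rewrite in_itv/= => /half_gauss_pdf_lt0 ->.
  apply: eq_integral => x; rewrite inE/= in_itv/= => /andP[x0 _].
  by rewrite half_gauss_pdf_ge0E.
- apply: measurable_funTS; apply/measurable_EFinP.
  exact: measurable_half_gauss_pdf.
- by move=> x _; rewrite lee_fin half_gauss_pdf_ge0.
Qed.

Lemma gauss_tail_ge0 (y : R) : 0 <= y -> 0 <= gauss_tail y.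
Proof.
move=> y0; have : (half_gauss_prob `]-oo, y] <= 1 :> \bar R)%E.
  by apply: probability_le1; exact: measurable_itv.
by rewrite half_gauss_cdf// lee_fin lerBlDl lerDr.
Qed.

Lemma gauss_tail_nincr (x y : R) : x <= y -> gauss_tail y <= gauss_tail x.
Proof.
move=> xy.
have cg : {within `[x, y], continuous gauss_tail}.
  apply: derivable_within_continuous => z _.
  by have [] := is_derive_gauss_tail z.
have [z _ E] := MVT_segment xy (fun x _ => is_derive_gauss_tail x) cg.
rewrite -subr_le0 E mulNr oppr_le0.
by rewrite mulr_ge0 ?gauss_ge0 ?subr_ge0.
Qed.

Lemma gauss_tail_lipschitz (x y : R) : x <= y ->
  gauss_tail x <= gauss_tail y + (y - x).
Proof.
move=> xy; rewrite -lerBlDl -[leRHS]mul1r.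
apply: le_trans (MVT_abs_le xy is_derive_gauss_tail (C := 1) _).
  by rewrite distrC ler_norm.
by move=> z _; rewrite normrN ger0_norm ?gauss_ge0// gauss_le1.
Qed.

Lemma half_gauss_cdf_lt0 (y : R) : y < 0 -> half_gauss_prob `]-oo, y] = 0.
Proof.
move=> y0; rewrite /half_gauss_prob integral0_eq// => x /=.
by rewrite in_itv/= => /le_lt_trans /(_ y0) /half_gauss_pdf_lt0 ->.
Qed.

(** The boundary value of the self-similar solution at x = 0: the limit law gives no mass to the
    negative half-line nor to the point 0. *)
Lemma gauss_tail0 : gauss_tail 0 = 1.
Proof.
have : half_gauss_prob `]-oo, (0 : R)] = 0.
  rewrite /half_gauss_prob -(@setUitv1 _ _ _ 0 true)// ge0_integral_setU//.
  - rewrite integral_set1 adde0 integral0_eq// => x /=.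
    by rewrite in_itv/= => /half_gauss_pdf_lt0 ->.
  - apply: measurable_funTS; apply/measurable_EFinP.
    exact: measurable_half_gauss_pdf.
  - by move=> x _; rewrite lee_fin half_gauss_pdf_ge0.
  - by apply/disj_setPS => x [] /=; rewrite in_itv/= => /[swap] ->; rewrite ltxx.
by rewrite half_gauss_cdf// => -[]/eqP; rewrite subr_eq0 => /eqP.
Qed.

(** Continuity from below of the limit law along the half-lines ]-oo, n], whose union has mass 1. *)
Lemma gauss_tail_cvg0 (e : R) : 0 < e -> exists2 y, 0 <= y & gauss_tail y <= e.
Proof.
move=> e0.
pose F (n : nat) : set R := `]-oo, n%:R]%classic.
have mF n : measurable (F n) by exact: measurable_itv.
have : half_gauss_prob (F n) @[n --> \oo] --> half_gauss_prob (\bigcup_n F n).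
  apply: nondecreasing_cvg_mu => //.
    exact: bigcupT_measurable.
  move=> m n mn; apply/subsetPset => x; rewrite /F/= !in_itv/= => /le_trans; apply.
  by rewrite ler_nat.
rewrite (_ : \bigcup_n _ = setT); last first.
  apply/seteqP; split=> // x _; exists (Num.bound `|x|) => //=.
  by rewrite /F/= in_itv/= (le_trans (ler_norm _))// ltW// archi_boundP.
rewrite probability_setT.
rewrite (_ : (fun n => _) = EFin \o (fun n : nat => 1 - gauss_tail n%:R)); last first.
  by apply/funext => n; rewrite /F half_gauss_cdf.
move=> /fine_cvgP[_] /cvgrPdist_le /(_ _ e0)[n _ /(_ n (leqnn n))] /=.
rewrite opprB addrC subrK => H; exists n%:R => //.
exact: le_trans (ler_norm _) H.
Qed.

End gauss_tail.

(** * Dual walkers *)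

Section dual_walkers.

(** Level [j] of [b] records the rings in the time cell number [j]. Levels are consumed from [k - 1]
    down to 0, hence backwards in time. *)
Fixpoint dual (b : nat -> int -> bool) (k : nat) (x : int) : int :=
  if k is j.+1 then dual b j (x + (b j x : nat)%:Z) else x.

(** The expectation of [h] at the final positions of two walkers that move independently while apart
    and together once equal. Leaving [h] free lets one recursion serve both the meeting event and
    the event that a walker goes far. *)
Fixpoint pair_law (R : realType) (p : R) (h : int -> int -> bool) (k : nat)
    (l r : int) : R :=
  if k is j.+1 then
    if l == r then
      p * pair_law p h j (l + 1) (l + 1) + (1 - p) * pair_law p h j l l
    else
      p ^+ 2 * pair_law p h j (l + 1) (r + 1)
      + p * (1 - p) * (pair_law p h j (l + 1) r + pair_law p h j l (r + 1))
      + (1 - p) ^+ 2 * pair_law p h j l r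
  else (h l r)%:R.

(** * Law of the dual pair driven by Bernoulli variables *)

Section law.
Context d (T : measurableType d) (R : realType) (P : probability T R).
Variables (b : nat -> int -> T -> bool) (p : R).
Local Notation bw w := (fun i x => b i x w).
Hypothesis mb : forall i x, measurable [set w | b i x w].
Hypothesis bern : forall s : seq (nat * int * bool), uniq (map fst s) ->
  P [set w | all (fun z => b z.1.1 z.1.2 w == z.2) s] =
  (\prod_(z <- s) (if z.2 then p else 1 - p))%:E.

Lemma measurable_bool_cst (c : bool) : measurable [set w : T | c].
Proof.
by case: c; [rewrite (_ : [set w | _] = setT)|rewrite (_ : [set w | _] = set0)];
  rewrite //; apply/seteqP; split.
Qed.

Lemma measurable_if_event i x (E F : T -> bool) :
  measurable [set w | E w] -> measurable [set w | F w] ->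
  measurable [set w | if b i x w then E w else F w].
Proof.
move=> mE mF.
rewrite (_ : [set w | _] = ([set w | b i x w] `&` [set w | E w]) `|`
   (~` [set w | b i x w] `&` [set w | F w])); last first.
  apply/seteqP; split => w /=; first by case: (b i x w); [left|right].
  by move=> [[->]//|[/negP/negbTE ->]].
by apply: measurableU; apply: measurableI => //; exact: measurableC.
Qed.

Lemma measurable_cylinder s :
  measurable [set w | all (fun z => b z.1.1 z.1.2 w == z.2) s].
Proof.
elim: s => [|[[i x] v] s IH] /=.
  exact: measurable_bool_cst.
rewrite (_ : [set w | _] = [set w | if b i x w then
    v && all (fun z => b z.1.1 z.1.2 w == z.2) s else
    ~~ v && all (fun z => b z.1.1 z.1.2 w == z.2) s]); last first.
  by apply/seteqP; split => w /=; case: (b i x w); case: v.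
by apply: measurable_if_event; case: v => //; exact: (measurable_bool_cst false).
Qed.

Lemma measurable_dual (h : int -> int -> bool) k l r :
  measurable [set w | h (dual (bw w) k l) (dual (bw w) k r)].
Proof.
elim: k l r => [|k IH] l r /=.
  exact: measurable_bool_cst.
rewrite (_ : [set w | _] = [set w |
  if b k l w then
    if b k r w then h (dual (bw w) k (l + 1)) (dual (bw w) k (r + 1))
    else h (dual (bw w) k (l + 1)) (dual (bw w) k (r + 0))
  else
    if b k r w then h (dual (bw w) k (l + 0)) (dual (bw w) k (r + 1))
    else h (dual (bw w) k (l + 0)) (dual (bw w) k (r + 0))]); last first.
  by apply/seteqP; split => w /=; case: (b k l w); case: (b k r w).
by do 2!apply: measurable_if_event.
Qed.

Lemma probability_split i x (E : T -> bool) : measurable [set w | E w] ->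
  P [set w | E w] =
  (P [set w | (b i x w == true) && E w] + P [set w | (b i x w == false) && E w])%E.
Proof.
move=> mE; rewrite -measureU//.
- congr (P _); apply/seteqP; split => w /=; first by case: (b i x w); [left|right].
  by move=> []/andP[].
- rewrite (_ : [set w | _] = [set w | if b i x w then E w else false]).
    by apply: measurable_if_event => //; exact: measurable_bool_cst.
  by apply/seteqP; split => w /=; case: (b i x w).
- rewrite (_ : [set w | _] = [set w | if b i x w then false else E w]).
    by apply: measurable_if_event => //; exact: measurable_bool_cst.
  by apply/seteqP; split => w /=; case: (b i x w).
- by apply/seteqP; split => w //= -[]; case: (b i x w).
Qed.

(* The cylinder [s] involves only levels that the walkers have already passed,
   hence it is independent of the rest of their trajectory. *)
Lemma cylinder_dual_law (h : int -> int -> bool) k l r s : uniq (map fst s) ->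
  all (fun z => (k <= z.1.1)%N) s ->
  P [set w | all (fun z => b z.1.1 z.1.2 w == z.2) s &&
      h (dual (bw w) k l) (dual (bw w) k r)] =
  ((\prod_(z <- s) (if z.2 then p else 1 - p)) * pair_law p h k l r)%:E.
Proof.
have mE h' k' l' r' s' : measurable [set w |
    all (fun z => b z.1.1 z.1.2 w == z.2) s' &&
      h' (dual (bw w) k' l') (dual (bw w) k' r')].
  rewrite (_ : [set w | _] =
    [set w | all (fun z => b z.1.1 z.1.2 w == z.2) s'] `&`
    [set w | h' (dual (bw w) k' l') (dual (bw w) k' r')]).
    by apply: measurableI; [exact: measurable_cylinder|exact: measurable_dual].
  by apply/seteqP; split => w /= => [/andP|[-> ->]].
elim: k l r s => [|k IH] l r s us ks.
  rewrite /=; case: (h l r).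
    rewrite mulr1 -bern//; congr (P _).
    by apply/seteqP; split => w /=; rewrite andbT.
  rewrite mulr0 (_ : [set w | _] = set0) ?measure0//.
  by apply/seteqP; split => w //=; rewrite andbF.
have ks' : all (fun z => (k <= z.1.1)%N) s.
  by apply: sub_all ks => z; exact: ltnW.
(* The walkers now read level [k], whereas [s] only involves higher levels; a bit revealed at level
   [k] therefore extends [s] to a cylinder that still has distinct keys. *)
have new x : (k, x) \notin map fst s.
  apply/negP => /mapP[[[i y] v] zs [ik _]].
  by move/allP : ks => /(_ _ zs) /=; rewrite -ik ltnn.
rewrite (probability_split k l)//.
have step v : P [set w | (b k l w == v) &&
     (all (fun z => b z.1.1 z.1.2 w == z.2) s &&
      h (dual (bw w) k.+1 l) (dual (bw w) k.+1 r))] =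
  if l == r then
    ((if v then p else 1 - p) * (\prod_(z <- s) (if z.2 then p else 1 - p)) *
      pair_law p h k (l + (v : nat)%:Z) (l + (v : nat)%:Z))%:E
  else ((if v then p else 1 - p) * (\prod_(z <- s) (if z.2 then p else 1 - p)) *
     (p * pair_law p h k (l + (v : nat)%:Z) (r + 1) +
      (1 - p) * pair_law p h k (l + (v : nat)%:Z) r))%:E.
  rewrite (_ : [set w | _] = [set w |
      all (fun z => b z.1.1 z.1.2 w == z.2) ((k, l, v) :: s) &&
      h (dual (bw w) k (l + (v : nat)%:Z)) (dual (bw w) k.+1 r)]); last first.
    by apply/seteqP; split => w /=; case: eqVneq => [->|].
  (* Walkers at the same site read the same bit, so nothing more has to be revealed; otherwise the
     bit at [r] is revealed too. *)
  case: eqVneq => [<-|lr].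
    rewrite (_ : [set w | _] = [set w |
      all (fun z => b z.1.1 z.1.2 w == z.2) ((k, l, v) :: s) &&
      h (dual (bw w) k (l + (v : nat)%:Z))
        (dual (bw w) k (l + (v : nat)%:Z))]); last first.
      by apply/seteqP; split => w /=; case: eqVneq => [->|].
    by rewrite IH/= ?new ?us ?leqnn//= big_cons.
  rewrite (probability_split k r); last first.
    rewrite (_ : [set w | _] = [set w | (b k l w == v) &&
     (all (fun z => b z.1.1 z.1.2 w == z.2) s &&
      h (dual (bw w) k.+1 l) (dual (bw w) k.+1 r))]).
      rewrite (_ : [set w | _] = [set w |
         all (fun z => b z.1.1 z.1.2 w == z.2) ((k, l, v) :: s) &&
      h (dual (bw w) k.+1 l) (dual (bw w) k.+1 r)])//.
      by apply/seteqP; split => w /=; rewrite andbA.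
    by apply/seteqP; split => w /=; case: eqVneq => [->|].
  have step2 v' : P [set w | (b k r w == v') &&
     (all (fun z => b z.1.1 z.1.2 w == z.2) ((k, l, v) :: s) &&
      h (dual (bw w) k (l + (v : nat)%:Z)) (dual (bw w) k.+1 r))] =
    ((if v' then p else 1 - p) * (if v then p else 1 - p) *
       (\prod_(z <- s) (if z.2 then p else 1 - p)) *
      pair_law p h k (l + (v : nat)%:Z) (r + (v' : nat)%:Z))%:E.
    rewrite (_ : [set w | _] = [set w |
      all (fun z => b z.1.1 z.1.2 w == z.2) ((k, r, v') :: (k, l, v) :: s) &&
      h (dual (bw w) k (l + (v : nat)%:Z))
        (dual (bw w) k (r + (v' : nat)%:Z))]); last first.
      by apply/seteqP; split => w /=; case: (eqVneq (b k r w)) => [->|].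
    rewrite IH/= ?new ?us ?leqnn ?andbT//= ?inE ?negb_or ?new ?andbT.
      by rewrite !big_cons/= !mulrA.
    by rewrite xpair_eqE eqxx/= eq_sym.
  by rewrite !step2 addr0 -EFinD; congr (_%:E); rewrite /=; ring.
rewrite !step/=; case: (eqVneq l r) => _; rewrite !addr0 -EFinD; congr (_%:E); ring.
Qed.

Lemma dual_law (h : int -> int -> bool) k l r :
  P [set w | h (dual (bw w) k l) (dual (bw w) k r)] =
  (pair_law p h k l r)%:E.
Proof. by have := @cylinder_dual_law h k l r [::] isT isT; rewrite big_nil mul1r. Qed.

End law.

(** * Comparison of the meeting probability with the heat equation *)

Section comparison.
Variables (R : realType) (p : R).
Hypothesis p01 : 0 <= p <= 1.
Local Notation sigma := (p * (1 - p)).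
Local Notation meet k := (pair_law p (fun l r => l == r) k).

Lemma pair_law_diag k l : meet k l l = 1.
Proof.
elim: k l => [|k IH] l /=; first by rewrite eqxx.
by rewrite eqxx !IH; ring.
Qed.

(** A discrete maximum principle. The gap r - l moves by +1 or -1 with probability [sigma] each, and
    stays put with probability p^2 + (1 - p)^2 = 1 - 2 sigma. All weights are nonnegative, so one
    step preserves the inequality; a positive gap cannot jump over 0, where the meeting probability
    is 1. *)
Lemma pair_law_supersolution (W : nat -> int -> R) :
  (forall k, 1 <= W k 0) -> (forall n : int, 0 < n -> 0 <= W 0%N n) ->
  (forall k (n : int), 0 < n ->
    (1 - 2 * sigma) * W k n + sigma * (W k (n + 1) + W k (n - 1)) <= W k.+1 n) ->
  forall k (l r : int), l <= r -> meet k l r <= W k (r - l).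
Proof.
move=> W1 W0 WS; have /andP[p0 p1] := p01.
elim=> [|k IH] l r; rewrite le_eqVlt => /predU1P[->|lr].
- by rewrite pair_law_diag subrr.
- by rewrite /= lt_eqF// W0// subr_gt0.
- by rewrite pair_law_diag subrr.
rewrite /= lt_eqF//; apply: le_trans (WS k (r - l) _); last by rewrite subr_gt0.
have IH1 := IH (l + 1) (r + 1) _; have IH2 := IH (l + 1) r _.
have IH3 := IH l (r + 1) _; have IH4 := IH l r _.
have {}IH1 : meet k (l + 1) (r + 1) <= W k (r - l).
  by rewrite (_ : r - l = r + 1 - (l + 1)); [apply: IH1; lia|lia].
have {}IH2 : meet k (l + 1) r <= W k (r - l - 1).
  by rewrite (_ : r - l - 1 = r - (l + 1)); [apply: IH2; lia|lia].
have {}IH3 : meet k l (r + 1) <= W k (r - l + 1).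
  by rewrite (_ : r - l + 1 = r + 1 - l); [apply: IH3; lia|lia].
have {}IH4 : meet k l r <= W k (r - l) by apply: IH4; lia.
have -> : (1 - 2 * sigma) * W k (r - l) +
    sigma * (W k (r - l + 1) + W k (r - l - 1)) =
    p ^+ 2 * W k (r - l) + sigma * (W k (r - l - 1) + W k (r - l + 1)) +
    (1 - p) ^+ 2 * W k (r - l) by ring.
have q0 : 0 <= 1 - p by rewrite subr_ge0.
by apply: lerD; [apply: lerD|]; rewrite ler_wpM2l ?sqr_ge0 ?mulr_ge0// lerD.
Qed.

(** The same induction with all inequalities reversed. *)
Lemma pair_law_subsolution (W : nat -> int -> R) :
  (forall k, W k 0 <= 1) -> (forall n : int, 0 < n -> W 0%N n <= 0) ->
  (forall k (n : int), 0 < n -> W k.+1 n <=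
    (1 - 2 * sigma) * W k n + sigma * (W k (n + 1) + W k (n - 1))) ->
  forall k (l r : int), l <= r -> W k (r - l) <= meet k l r.
Proof.
move=> W1 W0 WS; have /andP[p0 p1] := p01.
elim=> [|k IH] l r; rewrite le_eqVlt => /predU1P[->|lr].
- by rewrite pair_law_diag subrr.
- by rewrite /= lt_eqF// W0// subr_gt0.
- by rewrite pair_law_diag subrr.
rewrite /= lt_eqF//; apply: le_trans (WS k (r - l) _) _; first by rewrite subr_gt0.
have IH1 := IH (l + 1) (r + 1) _; have IH2 := IH (l + 1) r _.
have IH3 := IH l (r + 1) _; have IH4 := IH l r _.
have {}IH1 : W k (r - l) <= meet k (l + 1) (r + 1).
  by rewrite (_ : r - l = r + 1 - (l + 1)); [apply: IH1; lia|lia].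
have {}IH2 : W k (r - l - 1) <= meet k (l + 1) r.
  by rewrite (_ : r - l - 1 = r - (l + 1)); [apply: IH2; lia|lia].
have {}IH3 : W k (r - l + 1) <= meet k l (r + 1).
  by rewrite (_ : r - l + 1 = r + 1 - l); [apply: IH3; lia|lia].
have {}IH4 : W k (r - l) <= meet k l r by apply: IH4; lia.
have -> : (1 - 2 * sigma) * W k (r - l) +
    sigma * (W k (r - l + 1) + W k (r - l - 1)) =
    p ^+ 2 * W k (r - l) + sigma * (W k (r - l - 1) + W k (r - l + 1)) +
    (1 - p) ^+ 2 * W k (r - l) by ring.
have q0 : 0 <= 1 - p by rewrite subr_ge0.
by apply: lerD; [apply: lerD|]; rewrite ler_wpM2l ?sqr_ge0 ?mulr_ge0// lerD.
Qed.

Let sigma_bounds : 0 <= sigma <= 4^-1.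
Proof.
have /andP[p0 p1] := p01.
apply/andP; split; first by rewrite mulr_ge0// subr_ge0.
by have := sqr_ge0 (p - 2^-1); nra.
Qed.

Let error_ge0 (K : R) (k : nat) :
  0 <= 9 * (k%:R * sigma) * (Num.sqrt K)^-1 ^+ 3.
Proof.
have /andP[s0 _] := sigma_bounds.
apply: mulr_ge0; last by rewrite exprn_ge0// invr_ge0 sqrtr_ge0.
by apply: mulr_ge0 => //; apply: mulr_ge0.
Qed.

(** [heat_step] at time s = K + k sigma, with an error made uniform in [k] by s >= K. *)
Let heat_step_abs (K x : R) k : 1 <= K -> 0 <= x ->
  `|gauss_tail (x / Num.sqrt (K + k.+1%:R * sigma))
    - gauss_tail (x / Num.sqrt (K + k%:R * sigma))
    - sigma * (gauss_tail ((x + 1) / Num.sqrt (K + k%:R * sigma))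
               + gauss_tail ((x - 1) / Num.sqrt (K + k%:R * sigma))
               - 2 * gauss_tail (x / Num.sqrt (K + k%:R * sigma)))|
  <= 9 * sigma * (Num.sqrt K)^-1 ^+ 3.
Proof.
move=> K1 x0; have /andP[s0 s4] := sigma_bounds.
have k0 : 0 <= k%:R * sigma by rewrite mulr_ge0.
have -> : K + k.+1%:R * sigma = K + k%:R * sigma + sigma.
  by rewrite -natr1; ring.
have K1' : 1 <= K + k%:R * sigma by lra.
apply: le_trans (heat_step (@is_derive_gauss_tail R) x0 sigma_bounds K1') _.
apply: ler_wpM2l; first by rewrite mulr_ge0.
apply: lerXn2r; rewrite ?nnegrE ?invr_ge0 ?sqrtr_ge0//.
rewrite lef_pV2 ?posrE ?sqrtr_gt0; [|lra|lra].
by rewrite ler_wsqrtr// lerDl.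
Qed.

(** The right-hand side, seen as a function of [k] and of the gap, is a supersolution: the
    accumulated consistency error keeps it above 1 at gap 0, and it is nonnegative at [k = 0].
    Starting at time [K >= 1] avoids the singularity of the self-similar solution at time 0. *)
Lemma pair_law_meet_ub (K : R) k (l r : int) : 1 <= K -> l <= r ->
  meet k l r <= gauss_tail ((r - l)%:~R / Num.sqrt (K + k%:R * sigma))
    + 9 * (k%:R * sigma) * (Num.sqrt K)^-1 ^+ 3.
Proof.
move=> K1 lr; have /andP[s0 s4] := sigma_bounds.
pose W (k : nat) (n : int) : R :=
  gauss_tail (n%:~R / Num.sqrt (K + k%:R * sigma))
    + 9 * (k%:R * sigma) * (Num.sqrt K)^-1 ^+ 3.
apply: (@pair_law_supersolution W) => //.
- by move=> j; rewrite /W mulr0z mul0r gauss_tail0 lerDl error_ge0.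
- move=> n n0; rewrite /W !mul0r mulr0 mul0r !addr0 gauss_tail_ge0//.
  by rewrite divr_ge0 ?sqrtr_ge0// ler0z ltW.
- move=> j n n0; rewrite /W intrD intrB.
  have nn : 0 <= n%:~R :> R by rewrite ler0z ltW.
  have := heat_step_abs j K1 nn; rewrite ler_norml => /andP[+ _].
  rewrite -natr1; move: (gauss_tail _) (gauss_tail _) (gauss_tail _) (gauss_tail _).
  by move: (_ ^+ 3) (p * _) => c sg a1 a2 a3 a4; lra.
Qed.

(** At [k = 0] the solution shifted in space by [A] is at most [gauss_tail (A / Num.sqrt K)] for
    every positive gap. Subtracting this constant gives a nonpositive initial value, and subtracting
    the accumulated error gives a subsolution. *)
Lemma pair_law_meet_lb (K A : R) k (l r : int) : 1 <= K -> 0 <= A -> l <= r ->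
  gauss_tail (((r - l)%:~R + A) / Num.sqrt (K + k%:R * sigma))
    - gauss_tail (A / Num.sqrt K) - 9 * (k%:R * sigma) * (Num.sqrt K)^-1 ^+ 3
  <= meet k l r.
Proof.
move=> K1 A0 lr; have /andP[s0 s4] := sigma_bounds.
pose W (k : nat) (n : int) : R :=
  gauss_tail ((n%:~R + A) / Num.sqrt (K + k%:R * sigma))
    - gauss_tail (A / Num.sqrt K) - 9 * (k%:R * sigma) * (Num.sqrt K)^-1 ^+ 3.
apply: (@pair_law_subsolution W) => //.
- move=> j; rewrite /W mulr0z add0r.
  have AK : 0 <= A / Num.sqrt K by rewrite divr_ge0 ?sqrtr_ge0.
  have := gauss_tail_ge0 AK.
  have : gauss_tail (A / Num.sqrt (K + j%:R * sigma)) <= 1.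
    by rewrite -(gauss_tail0 R) gauss_tail_nincr// divr_ge0 ?sqrtr_ge0.
  by have := error_ge0 K j; lra.
- move=> n n0; rewrite /W !mul0r mulr0 mul0r subr0 addr0 subr_le0.
  rewrite gauss_tail_nincr// ler_wpM2r ?invr_ge0 ?sqrtr_ge0//.
  by rewrite lerDr ler0z ltW.
- move=> j n n0; rewrite /W intrD intrB.
  have nn : 0 <= n%:~R + A by rewrite addr_ge0// ler0z ltW.
  have := heat_step_abs j K1 nn; rewrite ler_norml => /andP[_].
  rewrite (addrAC _ A 1) (addrAC _ A (- 1)).
  rewrite -natr1; move: (gauss_tail _) (gauss_tail _) (gauss_tail _) (gauss_tail _)
   (gauss_tail _).
  by move: (_ ^+ 3) (p * _) => c sg a1 a2 a3 a4 a5; lra.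
Qed.

(** Markov's inequality for one walker, taken as a pair of equal walkers. Its mean final position x
    + k p satisfies the recursion with equality, and x / B dominates the indicator of B < x. *)
Lemma pair_law_far_ub (B : nat) k (x : nat) : (0 < B)%N ->
  pair_law p (fun _ r => (B%:Z < r)%R) k x%:Z x%:Z <= (x%:R + k%:R * p) / B%:R.
Proof.
have /andP[p0 p1] := p01; move=> B0.
have q0 : 0 <= 1 - p by rewrite subr_ge0.
elim: k x => [|k IH] x /=.
  rewrite mul0r addr0; case: ltrP => Bx; last by rewrite divr_ge0.
  by rewrite ler_pdivlMr ?ltr0n// mul1r ler_nat ltnW.
rewrite eqxx; have := IH x; have := IH x.+1.
rewrite -addn1 PoszD => /(ler_wpM2l p0) + /(ler_wpM2l q0).
move=> /lerD /[apply] /le_trans; apply.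
rewrite -(natr1 k) natrD le_eqVlt; apply/orP; left; apply/eqP; field.
by rewrite pnatr_eq0 -lt0n.
Qed.

End comparison.
End dual_walkers.

(** * Discretized clocks *)

Section poisson_grid.
Context d (T : measurableType d) (R : realType) (P : probability T R).
Variables (N : int -> R -> {RV P >-> nat}) (lam : R).
Hypothesis lam0 : 0 < lam.
Hypothesis NP : forall x, poisson_process 1 (N x).
Hypothesis Nind : independent_processes N.

Definition grid_increment (i : nat) (x : int) (w : T) : nat :=
  (N x (lam * i.+1%:R) w - N x (lam * i%:R) w)%N.
Local Notation inc := grid_increment.

Lemma measurable_grid_increment i x (D : set nat) :
  measurable (inc i x @^-1` D).
Proof.
pose E k m : set T := if `[< D (k - m)%N >]
  then (N x (lam * i.+1%:R) @^-1` [set k]) `&` (N x (lam * i%:R) @^-1` [set m])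
  else set0.
rewrite (_ : _ @^-1` _ = \bigcup_k \bigcup_m E k m); last first.
  apply/seteqP; split => w /=.
    move=> Dw; exists (N x (lam * i.+1%:R) w) => //.
    by exists (N x (lam * i%:R) w) => //; rewrite /E; case: asboolP.
  move=> [k _ [m _]]; rewrite /E; case: asboolP => //= Dkm [Ek Em].
  by rewrite /grid_increment Ek Em.
do 2!(apply: bigcupT_measurable => ?).
rewrite /E; case: asboolP => _ //.
by apply: measurableI; rewrite -[X in measurable X]setTI; exact: measurable_funP.
Qed.

Let grid_ge0 i : 0 <= lam * i%:R.
Proof. by rewrite mulr_ge0// ltW. Qed.

(** Two independences are combined: that of the clocks, applied to their vectors of values at the
    grid times, and that of the increments of each clock. *)
Lemma grid_increments_independent :
  mutually_independent P (fun z : nat * int => inc z.1 z.2).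
Proof.
move=> s B us.
pose M := (\max_(z <- s) z.1).+1.
have sM z : z \in s -> (z.1 < M)%N by move=> zs; rewrite ltnS leq_bigmax_seq.
pose xs := undup (map snd s).
(* Pairs absent from [s] receive the trivial event, so that each clock occurring in [s] carries one
   event for every cell below [M]. *)
pose D i x : set nat := if (i, x) \in s then B (i, x) else setT.
pose ts := [seq lam * i%:R | i <- iota 0 M.+1].
(* Independence of the clocks concerns vectors of values, so the conditions on increments are
   rewritten as one condition on such a vector. *)
pose C x : set (seq nat) :=
  [set v | forall i : 'I_M, D i x (nth 0%N v i.+1 - nth 0%N v i)%N].
pose Y x w := [seq N x t w | t <- ts].
have nthY x w i : (i < M.+1)%N -> nth 0%N (Y x w) i = N x (lam * i%:R) w.
  move=> iM; rewrite /Y (nth_map 0) ?size_map ?size_iota//.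
  by rewrite /ts (nth_map 0%N) ?size_iota// nth_iota.
have diffY x w (i : 'I_M) :
    (nth 0%N (Y x w) i.+1 - nth 0%N (Y x w) i)%N = inc i x w.
  have i1 : (i.+1 < M.+1)%N by rewrite ltnS.
  by rewrite (nthY _ _ _ i1) (nthY _ _ _ (ltnW i1)).
have YC x : Y x @^-1` C x = \big[setI/setT]_(i <- index_enum 'I_M) (inc i x @^-1` D i x).
  rewrite -bigcap_seq; apply/seteqP; split => w /=.
    by move=> Cw i _; have := Cw i; rewrite !diffY.
  move=> Cw i; have := Cw i; rewrite /= mem_index_enum => /(_ isT).
  by rewrite !diffY.
have -> : \big[setI/setT]_(z <- s) (inc z.1 z.2 @^-1` B z) =
    \big[setI/setT]_(x <- xs) (Y x @^-1` C x).
  rewrite -!bigcap_seq; apply/seteqP; split => w /=.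
    move=> H x _; rewrite YC -bigcap_seq => i /= _.
    by rewrite /D; case: ifPn => // ixs; exact: (H (val i, x)).
  move=> H [i x] zs /=.
  have xxs : x \in xs by rewrite mem_undup; apply/mapP; exists (i, x).
  have : (Y x @^-1` C x) w := H x xxs.
  rewrite YC -bigcap_seq => /(_ (Ordinal (sM _ zs))) /=.
  by rewrite mem_index_enum => /(_ isT); rewrite /D zs.
rewrite Nind ?undup_uniq//; last first.
  by move=> t /mapP[i _ ->]; exact: grid_ge0.
have PD i x : P (inc i x @^-1` D i x) =
    (if (i, x) \in s then P (inc i x @^-1` B (i, x)) else 1%E).
  rewrite /D; case: ifPn => // _.
  by rewrite preimage_setT probability_setT.
transitivity (\prod_(x <- xs) \prod_(0 <= i < M)
    if (i, x) \in s then P (inc i x @^-1` B (i, x)) else 1%E)%E.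
  apply: eq_bigr => x _; rewrite YC.
  have [_ _ _ _ incr] := NP x.
  have := incr M (fun i => lam * i%:R) (grid_ge0 0) _ (index_enum 'I_M) (fun i => D i x)
    (index_enum_uniq _).
  move=> ->; last by move=> i; rewrite ler_wpM2l ?ler_nat// ltW.
  by rewrite big_mkord; apply: eq_bigr => i _; exact: PD.
(* The double product becomes a product over a rectangle of pairs; the factors outside [s] equal 1,
   and the remaining pairs are a permutation of [s]. *)
transitivity (\prod_(z <- [seq (i, x) | x <- xs, i <- index_iota 0 M])
    if z \in s then P (inc z.1 z.2 @^-1` B z) else 1%E)%E.
  by rewrite big_allpairs_dep.
rewrite -big_mkcond -big_filter; apply: perm_big; apply: uniq_perm => //.
  apply: filter_uniq; apply: allpairs_uniq => //; first exact: undup_uniq.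
    exact: iota_uniq.
  by move=> [? ?] [? ?] _ _ [-> ->].
move=> [i x]; rewrite mem_filter; case: (boolP ((i, x) \in s)) => // zs; rewrite andTb.
apply/allpairsPdep; exists x, i; split=> //=.
  by rewrite mem_undup; apply/mapP; exists (i, x).
by rewrite mem_index_iota; exact: sM zs.
Qed.

Lemma grid_increment_pmf i x k :
  P [set w | inc i x w = k] = (lam ^+ k / k`!%:R * expR (- lam))%:E.
Proof.
have [_ _ _ pmf _] := NP x.
have -> : lam ^+ k / k`!%:R * expR (- lam) =
    poisson_pmf (1 * (lam * i.+1%:R - lam * i%:R)) k.
  by rewrite -mulrBr -natr1 addrAC subrr add0r mulr1 mul1r /poisson_pmf lam0.
by apply: pmf; rewrite grid_ge0/= ltr_pM2l// ltr_nat.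
Qed.

Definition rung (i : nat) (x : int) (w : T) : bool := (0 < inc i x w)%N.

Definition ring_prob : R := 1 - expR (- lam).

Lemma ring_prob01 : 0 <= ring_prob <= 1.
Proof.
by rewrite /ring_prob subr_ge0 -expR0 ler_expR oppr_le0 ltW//= lerBlDl lerDr expR_ge0.
Qed.

Lemma ring_prob_le : ring_prob <= lam.
Proof. by rewrite /ring_prob lerBlDl -lerBlDr; exact: expR_ge1Dx. Qed.

(** The variance of one step agrees with [lam] to first order. Here exp(-lam) >= 1 - lam and 1 -
    exp(-lam) >= lam exp(-lam), so the variance is at least lam (1 - lam)^2. *)
Lemma ring_variance_lb : lam <= 1 ->
  lam - 2 * lam ^+ 2 <= ring_prob * (1 - ring_prob).
Proof.
move=> lam1; rewrite /ring_prob opprB addrCA subrr addr0.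
have e1 : 1 - lam <= expR (- lam) by exact: expR_ge1Dx.
have e2 : lam * expR (- lam) <= 1 - expR (- lam).
  have := ler_wpM2r (expR_ge0 (- lam)) (expR_ge1Dx lam).
  by rewrite -expRD subrr expR0 mulrDl mul1r -lerBrDl.
have := expR_ge0 (- lam); move: (expR (- lam)) e1 e2 => e e1 e2 e0.
have : (1 - lam) * (lam * (1 - lam)) <= e * (1 - e).
  apply: ler_pM => //; first by rewrite subr_ge0.
    by rewrite mulr_ge0 ?subr_ge0// ltW.
  by apply: le_trans e2; rewrite ler_wpM2l// ltW.
by have := exprn_ge0 3 (ltW lam0); lra.
Qed.

Lemma ring_variance_ub : ring_prob * (1 - ring_prob) <= lam.
Proof.
have /andP[p0 p1] := ring_prob01; apply: le_trans ring_prob_le.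
by rewrite ler_piMr// lerBlDl lerDr.
Qed.

Lemma measurable_rung i x : measurable [set w | rung i x w].
Proof. exact: (measurable_grid_increment i x [set k | (0 < k)%N]). Qed.

Lemma rung_probability i x v :
  P [set w | rung i x w = v] = (if v then ring_prob else 1 - ring_prob)%:E.
Proof.
have H0 : P [set w | rung i x w = false] = (1 - ring_prob)%:E.
  rewrite (_ : [set w | _] = [set w | inc i x w = 0%N]); last first.
    apply/seteqP; split => w; rewrite /rung /=; first by rewrite lt0n => /negbFE/eqP.
    by move=> ->.
  rewrite grid_increment_pmf expr0 fact0 divr1 mul1r /ring_prob.
  by rewrite opprB addrCA subrr addr0.
case: v => //.
rewrite (_ : [set w | _] = ~` [set w | rung i x w = false]); last first.
  by apply/seteqP; split => w /=; case: (rung i x w).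
rewrite probability_setC ?H0.
  by rewrite -EFinB; congr (_%:E); ring.
exact: (measurable_grid_increment i x [set k | (0 < k)%N = false]).
Qed.

Lemma rung_bernoulli (s : seq (nat * int * bool)) : uniq (map fst s) ->
  P [set w | all (fun z => rung z.1.1 z.1.2 w == z.2) s] =
  (\prod_(z <- s) (if z.2 then ring_prob else 1 - ring_prob))%:E.
Proof.
move=> us.
have fst_inj z z' : z \in s -> z' \in s -> z.1 = z'.1 -> z = z'.
  elim: s us => //= a s IH /andP[an us].
  rewrite !inE => /predU1P[->|zs] /predU1P[->|zs']//; last exact: IH.
    by move=> E; rewrite E map_f in an.
  by move=> E; rewrite -E map_f in an.
have keyE z : z \in s -> ((z.1, true) \in s) = z.2.
  move=> zs; apply/idP/idP => [z1s|]; last by case: z zs => y [].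
  by rewrite -(fst_inj _ _ z1s zs).
(* The keys of [s] are distinct, so the bit prescribed for a key is recovered by testing whether the
   key occurs with [true]. *)
pose B (y : nat * int) : set nat := [set k | (0 < k)%N = ((y, true) \in s)].
rewrite (_ : [set w | _] =
    \big[setI/setT]_(y <- map fst s) (inc y.1 y.2 @^-1` B y)); last first.
  rewrite -bigcap_seq; apply/seteqP; split => w /=.
    move=> /allP H y /= /mapP[z zs ->]; rewrite /B/= keyE//.
    by have /eqP := H z zs.
  move=> H; apply/allP => z zs; apply/eqP; rewrite -keyE//.
  by apply: (H z.1) => /=; exact: map_f.
rewrite grid_increments_independent// big_map -prodEFin.
apply: eq_big_seq => z zs; rewrite -(rung_probability z.1.1 z.1.2); congr (P _).
by apply/seteqP; split => w; rewrite /B/= keyE.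
Qed.

Lemma two_rings_probability i x : (P [set w | (1 < inc i x w)%N] <= (lam ^+ 2)%:E)%E.
Proof.
have m2 k : measurable [set w | inc i x w = k].
  exact: (measurable_grid_increment i x [set k]).
rewrite (_ : [set w | _] = ~` ([set w | inc i x w = 0%N] `|` [set w | inc i x w = 1%N])); last first.
  apply/seteqP; split => w /=; first by move=> + [] E; rewrite E.
  by case: (inc i x w) => [|[|k]]// H; exfalso; apply: H; [left|right].
rewrite probability_setC; last exact: measurableU.
have -> : (P ([set w | inc i x w = 0%N] `|` [set w | inc i x w = 1%N]) =
    P [set w | inc i x w = 0%N] + P [set w | inc i x w = 1%N])%E.
  by apply: measureU => //; apply/seteqP; split => w //= -[->].
rewrite !grid_increment_pmf -!EFinD lee_fin expr0 expr1 fact0 factS fact0 muln1 !divr1 mul1r.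
(* From exp(-lam) >= 1 - lam: 1 - (1 + lam) exp(-lam) <= 1 - (1 + lam)(1 - lam) = lam^2. *)
have := ler_wpM2l (addr_ge0 ler01 (ltW lam0)) (expR_ge1Dx (- lam)).
by move: (expR _) => e; lra.
Qed.

(** One family covers both ways of having two rings in a cell: the diagonal handles a clock ringing
    twice, the other entries two different clocks. Both have probability at most lam^2. *)
Definition bad_pair (i : nat) (x y : int) : set T :=
  if x == y then [set w | (1 < inc i x w)%N] else [set w | rung i x w && rung i y w].

Lemma measurable_bad_pair i x y : measurable (bad_pair i x y).
Proof.
rewrite /bad_pair; case: ifP => _.
  exact: (measurable_grid_increment i x [set k | (1 < k)%N]).
rewrite (_ : [set w | _] = [set w | rung i x w] `&` [set w | rung i y w]).
  by apply: measurableI; exact: measurable_rung.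
by apply/seteqP; split => w /= => [/andP|[-> ->]].
Qed.

Lemma bad_pair_probability i x y : (P (bad_pair i x y) <= (lam ^+ 2)%:E)%E.
Proof.
rewrite /bad_pair; case: eqVneq => [_|xy]; first exact: two_rings_probability.
have := @rung_bernoulli [:: ((i, x), true); ((i, y), true)].
rewrite /= inE xpair_eqE eqxx/= (negbTE xy) => /(_ isT).
rewrite (_ : [set w | _] = [set w | rung i x w && rung i y w]); last first.
  by apply/seteqP; split => w /=; rewrite andbT !eqb_id.
move=> ->; rewrite lee_fin !big_cons big_nil mulr1 expr2.
by have /andP[p0 p1] := ring_prob01; apply: ler_pM => //; exact: ring_prob_le.
Qed.

Definition bad_grid (M : nat) (xs : seq int) : set T :=
  \big[setU/set0]_(i <- iota 0 M) \big[setU/set0]_(x <- xs)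
    \big[setU/set0]_(y <- xs) bad_pair i x y.

Let bigsetU_le (I : Type) (s : seq I) (F : I -> set T) (c : R) :
  (forall i, measurable (F i)) -> (forall i, P (F i) <= c%:E)%E ->
  (P (\big[setU/set0]_(i <- s) F i) <= ((size s)%:R * c)%:E)%E.
Proof.
move=> mF Fc; elim: s => [|i s IH]; first by rewrite big_nil measure0 mul0r.
rewrite big_cons; set B := \big[_/_]_(_ <- s) _ in IH *.
have U : (P (F i `|` B) <= P (F i) + P B)%E.
  by apply: measureU2 => //; exact: bigsetU_measurable.
by apply: (le_trans U); rewrite /= -natr1 mulrDl mul1r addrC EFinD leeD.
Qed.

Lemma measurable_bad_grid M xs : measurable (bad_grid M xs).
Proof.
by do 3!(apply: bigsetU_measurable => ? _); exact: measurable_bad_pair.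
Qed.

(** A union bound; with lam = t / M it is of order 1 / M for a fixed box [xs]. *)
Lemma bad_grid_probability M xs :
  (P (bad_grid M xs) <= (M%:R * ((size xs)%:R * ((size xs)%:R * lam ^+ 2)))%:E)%E.
Proof.
rewrite -{2}(size_iota 0 M); apply: bigsetU_le => i.
  by do 2!(apply: bigsetU_measurable => ? _); exact: measurable_bad_pair.
apply: bigsetU_le => x.
  by apply: bigsetU_measurable => ? _; exact: measurable_bad_pair.
apply: bigsetU_le => y; first exact: measurable_bad_pair.
exact: bad_pair_probability.
Qed.

Lemma not_bad_gridP M xs w : ~ bad_grid M xs w ->
  forall i x y, (i < M)%N -> x \in xs -> y \in xs -> ~ bad_pair i x y w.
Proof.
move=> nb i x y iM xxs yxs bp; apply: nb.
rewrite /bad_grid -bigcup_seq; exists i; first by rewrite /= mem_iota.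
rewrite -bigcup_seq; exists x => //.
by rewrite -bigcup_seq; exists y.
Qed.

End poisson_grid.

(** * Pathwise duality *)

Section pathwise_duality.
Variable R : realType.

(** The jump time is the supremum of the times at which [f] still equals [f s]. Right continuity
    forbids [f tau = f s], and monotonicity then leaves only the value [f t]. *)
Lemma jump_time (f : R -> nat) (s t : R) : 0 <= s -> s < t ->
  (forall u v, 0 <= u <= v -> (f u <= f v)%N) ->
  (forall u, 0 <= u -> \forall v \near u^'+, f v = f u) ->
  f t = (f s).+1 ->
  exists2 tau, s < tau <= t &
    (forall u, s <= u < tau -> f u = f s) /\ f tau = f t.
Proof.
move=> s0 st mono rc fts.
pose A := [set u | s <= u <= t /\ f u = f s].
have As : A s by split => //; rewrite lexx ltW.
have ubA : ubound A t by move=> u [/andP[]].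
have supA : has_sup A by split; [exists s|exists t].
pose tau := sup A.
have s_tau : s <= tau by apply: ub_le_sup => //; exists t.
have tau_t : tau <= t by apply: ge_sup => //; exists s.
have tau0 : 0 <= tau by exact: le_trans s_tau.
have before u : s <= u < tau -> f u = f s.
  move=> /andP[su ut]; have tu0 : 0 < tau - u by rewrite subr_gt0.
  have [v [/andP[sv vt] fv]] := sup_adherent tu0 supA.
  rewrite -/tau => tv; have uv : u < v by lra.
  apply/eqP; rewrite eqn_leq; apply/andP; split.
    by rewrite -fv; apply: mono; rewrite (le_trans s0 su) ltW.
  by rewrite mono// s0.
have after : f tau <> f s.
  move=> ftau.
  have taut : tau < t.
    rewrite lt_neqAle tau_t andbT; apply/eqP => E.
    by move: ftau; rewrite E fts => /eqP; rewrite -[_.+1]addn1 -[X in _ == X]addn0 eqn_add2l.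
  have : \forall v \near tau^'+, [/\ tau < v, v <= t & f v = f tau].
    near=> v; split.
    - by near: v; exact: nbhs_right_gt.
    - by near: v; exact: nbhs_right_le.
    - by near: v; exact: rc.
  move=> /filter_ex[v [tv vt fv]].
  have : v <= tau.
    apply: ub_le_sup; first by exists t.
    by split; [rewrite vt (le_trans s_tau)// ltW|rewrite fv].
  by rewrite leNgt tv.
have s_tau' : s < tau.
  rewrite lt_neqAle s_tau andbT; apply/eqP => E; by apply: after; rewrite -E.
exists tau; first by rewrite s_tau'.
split => //.
have h1 : (f s <= f tau)%N by rewrite mono// s0.
have h2 : (f tau <= f t)%N by rewrite mono// tau0.
by lia.
Unshelve. all: by end_near.
Qed.

Variables (N : int -> R -> nat) (xi0 : int -> bool) (xi : R -> int -> bool).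
Hypothesis mono : forall x u v, 0 <= u <= v -> (N x u <= N x v)%N.
Hypothesis rc : forall x u, 0 <= u -> \forall v \near u^'+, N x v = N x u.
Hypothesis path : coalescence_path N xi0 xi.

Lemma N_constant x (s u v t : R) : 0 <= s -> s <= u -> u <= v -> v <= t ->
  N x t = N x s -> N x u = N x v.
Proof.
move=> s0 su uv vt E.
have h1 : (N x s <= N x u)%N by rewrite mono// s0.
have h2 : (N x u <= N x v)%N by rewrite mono// (le_trans s0 su).
have h3 : (N x v <= N x t)%N by rewrite mono// (le_trans s0 (le_trans su uv)).
by lia.
Qed.

(** The half-open interval suits the clocks: a ring at [l] empties l + 1 whatever it held, and a
    ring at [r] brings the particle of r + 1 to r. Hence both endpoints obey the same rule backwards
    in time. *)
Definition vacant (t : R) (l r : int) : Prop :=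
  forall x, l < x <= r -> xi t x = false.

Lemma coalesce_or p : (coalesce p).1 = p.1 || p.2.
Proof. by case: p => -[] []. Qed.

Lemma coalesce_snd p : (coalesce p).2 = false.
Proof. by case: p => -[] []. Qed.

(** At most one clock [x] of the box rings, and only once. If x = l, the condition at l + 1 is
    dropped; if x = r, the condition at r + 1 is added. If x lies strictly between, the pair x, x +
    1 is vacant afterwards exactly when it was before; if x = r + 1, no site of the interval
    changes. The box reaches r + 1 because the value there must stay known until the ring of [r]. *)
Lemma vacant_step (s t : R) (l r : int) : 0 <= s -> s < t -> l <= r ->
  (forall x, l <= x <= r + 1 -> (N x t - N x s <= 1)%N) ->
  (forall x y, l <= x <= r + 1 -> l <= y <= r + 1 -> x != y ->
    (0 < N x t - N x s)%N -> N y t = N y s) ->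
  vacant t l r <->
  vacant s (l + ((0 < N l t - N l s)%N : nat)%:Z)
           (r + ((0 < N r t - N r s)%N : nat)%:Z).
Proof.
move=> s0 st; rewrite le_eqVlt => /predU1P[<-|lr] one two.
  by split => _ x; rewrite ltNge andNb.
have st' := ltW st.
have [_ ringP constP] := path.
have same z : N (z - 1) t = N (z - 1) s -> N z t = N z s -> xi t z = xi s z.
  by move=> E1 E2; apply: constP; rewrite ?s0.
have [[x xbox Nx]|none] := pselect (exists2 x, l <= x <= r + 1 & (0 < N x t - N x s)%N);
    last first.
  have E x : l <= x <= r + 1 -> N x t = N x s.
    move=> xb; have h1 : (N x s <= N x t)%N by rewrite mono// s0.
    have : ~ (0 < N x t - N x s)%N by move=> ?; apply: none; exists x.
    by lia.
  rewrite !E ?subnn ?addr0; [|lia|lia].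
  by split => V z zb; [rewrite -same|rewrite same]; rewrite ?V// E//; lia.
have others y : l <= y <= r + 1 -> y != x -> N y t = N y s.
  by move=> yb yx; apply: (two x); rewrite // eq_sym.
have Nxt : N x t = (N x s).+1 by have := one x xbox; lia.
have [tau /andP[stau taut] [before Ntau]] := jump_time s0 st (mono x) (rc x) Nxt.
have tau0 : 0 <= tau by rewrite (le_trans s0)// ltW.
have xring : rings (N x) tau.
  split; first exact: le_lt_trans stau.
  near=> u; rewrite (before u) ?Ntau ?Nxt//; apply/andP; split; near: u.
    exact: nbhs_left_ge.
  exact: nbhs_left_lt.
(* The configuration near the interval is frozen before [tau] and again from [tau] on, so the whole
   change over [s, t] is the single update at [tau]. *)
have before_tau z u : l < z <= r + 1 -> s <= u < tau -> xi u z = xi s z.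
  move=> zb /andP[su ut]; have const y : l <= y <= r + 1 -> N y s = N y u.
    move=> yb; have [->|yx] := eqVneq y x; first by rewrite before// su.
    by apply: (N_constant s0 _ su _ (others _ yb yx)) => //; rewrite ltW// (lt_le_trans ut).
  by apply: constP; rewrite ?s0 ?su//; apply: const; clear -zb; lia.
have after_tau z : l < z <= r + 1 -> xi t z = xi tau z.
  move=> zb; have const y : l <= y <= r + 1 -> N y tau = N y t.
    move=> yb; have [->//|yx] := eqVneq y x.
    by apply: (N_constant s0 (ltW stau) taut _ (others _ yb yx)).
  by apply: constP; rewrite ?tau0 ?taut//; apply: const; clear -zb; lia.
have update : exists2 u, s <= u < tau &
    (xi tau x, xi tau (x + 1)) = coalesce (xi u x, xi u (x + 1)).
  near tau^'- => u; exists u; last by near: u; exact: ringP.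
  by apply/andP; split; near: u; [exact: nbhs_left_ge|exact: nbhs_left_lt].
case: update => u su upd.
have updx : l < x <= r -> xi t x = xi s x || xi s (x + 1).
  move=> xb; rewrite after_tau; last by clear -xb; lia.
  have := congr1 fst upd; rewrite coalesce_or/= => ->.
  by rewrite !before_tau//; clear -xb; lia.
have updx1 : x <= r -> xi t (x + 1) = false.
  move=> xb; rewrite after_tau; last by clear -xb xbox; lia.
  by have := congr1 snd upd; rewrite coalesce_snd.
have ring0 y : l <= y <= r + 1 -> y != x -> (0 < N y t - N y s)%N = false.
  by move=> yb yx; rewrite others// subnn.
have same' z : l < z <= r -> z != x -> z != x + 1 -> xi t z = xi s z.
  move=> zb zx zx1; apply: same; apply: others.
  - by clear -zb; lia.
  - by rewrite subr_eq.
  - by clear -zb; lia.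
  - by [].
have ring0l : x != l -> (0 < N l t - N l s)%N = false.
  by move=> xl; apply: ring0; rewrite 1?eq_sym//; clear -lr; lia.
have ring0r : x != r -> (0 < N r t - N r s)%N = false.
  by move=> xr; apply: ring0; rewrite 1?eq_sym//; clear -lr; lia.
clear one two others ring0 same before_tau after_tau upd.
have [xl|xl] := eqVneq x l.
  rewrite ring0r; last by rewrite xl lt_eqF.
  rewrite (_ : (0 < N l t - N l s)%N = true) ?addr0; last by rewrite -xl.
  rewrite xl in updx1 same'.
  split => V z zb.
    by rewrite -same' ?V//; clear -zb; lia.
  have [->|zx1] := eqVneq z (l + 1); first by apply: updx1; clear -lr; lia.
  by rewrite same' ?V//; clear -zb zx1; lia.
rewrite ring0l// addr0.
have [xr|xr] := eqVneq x r.
  rewrite (_ : (0 < N r t - N r s)%N = true); last by rewrite -xr.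
  rewrite xr in updx updx1 same'.
  have updx' := updx (introT andP (conj lr (lexx r))).
  split => V z zb.
    have : xi t r = false by apply: V; rewrite lr lexx.
    rewrite updx' => /negbT; rewrite negb_or => /andP[/negbTE h1 /negbTE h2].
    have [->//|zx] := eqVneq z r; have [->//|zx1] := eqVneq z (r + 1).
    by rewrite -same' ?V//; clear -zb zx1; lia.
  have [->|zx] := eqVneq z r; first by rewrite updx' !V//; clear -lr; lia.
  by rewrite same' ?V//; clear -zb zx; lia.
rewrite ring0r// addr0.
have [xr1|xr1] := eqVneq x (r + 1).
  rewrite xr1 in same'.
  by split => V z zb; [rewrite -same'|rewrite same']; rewrite ?V//; clear -zb; lia.
have xlr : l < x < r by clear -xbox xl xr xr1; lia.
have updx' : xi t x = xi s x || xi s (x + 1) by apply: updx; clear -xlr; lia.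
have updx1' : xi t (x + 1) = false by apply: updx1; clear -xlr; lia.
split => V z zb.
  have : xi t x = false by apply: V; clear -xlr; lia.
  rewrite updx' => /negbT; rewrite negb_or => /andP[/negbTE h1 /negbTE h2].
  have [->//|zx] := eqVneq z x; have [->//|zx1] := eqVneq z (x + 1).
  by rewrite -same' ?V//; clear -zb; lia.
have [->|zx] := eqVneq z x; first by rewrite updx' !V//; clear -xlr; lia.
have [->//|zx1] := eqVneq z (x + 1).
by rewrite same' ?V//; clear -zb; lia.
Unshelve. all: by end_near.
Qed.

Lemma le_dual b k x : x <= dual b k x.
Proof.
elim: k x => [|k IH] x //=; apply: le_trans (IH _); by rewrite lerDl.
Qed.

(** Walkers at distinct sites are at least 1 apart and move by at most 1, while equal walkers move
    together; so they never cross. *)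
Lemma dual_homo b k (l r : int) : l <= r -> dual b k l <= dual b k r.
Proof.
elim: k l r => [|k IH] l r //= lr; apply: IH.
by move: lr; rewrite le_eqVlt => /predU1P[->//|]; case: (b k l); case: (b k r) => /=; lia.
Qed.

(** [vacant_step] is iterated over the cells, from the last one down. The walkers only move right,
    so every clock consulted lies between the initial [l] and [hi], which exceeds the final right
    endpoint by at least 1. *)
Lemma vacant_dual (lam : R) (M : nat) (hi : int) : 0 < lam -> forall (l r : int) k,
  let inc i x := (N x (lam * i.+1%:R) - N x (lam * i%:R))%N in
  let b i x := (0 < inc i x)%N in
  (k <= M)%N -> l <= r -> dual b k r + 1 <= hi ->
  (forall i x, (i < M)%N -> l <= x <= hi -> (inc i x <= 1)%N) ->
  (forall i x y, (i < M)%N -> l <= x <= hi -> l <= y <= hi -> x != y ->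
     ~~ (b i x && b i y)) ->
  vacant (lam * k%:R) l r <-> vacant 0 (dual b k l) (dual b k r).
Proof.
move=> lam0 l r k inc b; elim: k l r => [|k IH] l r kM lr rhi one two.
  by rewrite mulr0.
have step := @vacant_step (lam * k%:R) (lam * k.+1%:R) l r _ _ lr.
have rb : r <= r + (b k r : nat)%:Z by rewrite lerDl.
have lb : l <= l + (b k l : nat)%:Z by rewrite lerDl.
have rd := le_dual b k (r + (b k r : nat)%:Z).
have lrb : l + (b k l : nat)%:Z <= r + (b k r : nat)%:Z.
  move: lr; rewrite le_eqVlt => /predU1P[->//|].
  by case: (b k l); case: (b k r) => /=; lia.
rewrite step.
- apply: IH => //.
  + exact: ltnW.
  + by move=> i x iM xb; apply: one => //; move: rhi => /=; lia.
  + by move=> i x y iM xb yb; apply: two => //; lia.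
- by rewrite mulr_ge0// ltW.
- by rewrite ltr_pM2l// ltr_nat.
- by move=> x xb; apply: one => //; move: rhi => /=; lia.
- move=> x y xb yb xy Nx.
  have := two k x y kM _ _ xy.
  rewrite /b /inc Nx /= => H.
  have : (N y (lam * k%:R) <= N y (lam * k.+1%:R))%N.
    by apply: mono; rewrite mulr_ge0 ?ler_wpM2l ?ler_nat// ltW.
  suff : ~~ (0 < N y (lam * k.+1%:R) - N y (lam * k%:R))%N by lia.
  by apply: H; move: rhi => /=; lia.
Qed.

End pathwise_duality.

(** * Vacancy probabilities *)

Section vacancy.
Context d (T : measurableType d) (R : realType) (P : probability T R).
Variables (N : int -> R -> {RV P >-> nat}) (xi : R -> int -> {RV P >-> bool}).
Hypothesis proc : coalescence_process N fully_packed xi.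

Definition vacancy (t : R) (n : nat) : set T :=
  [set w | vacant (fun s x => xi s x w) t (- n%:Z) 0].

Lemma measurable_vacancy t n : measurable (vacancy t n).
Proof.
rewrite (_ : vacancy t n =
    \big[setI/setT]_(k <- iota 0 n) (xi t (- k%:Z) @^-1` [set false])).
  apply: bigsetI_measurable => k _.
  by rewrite -[X in measurable X]setTI; exact: measurable_funP.
rewrite -bigcap_seq; apply/seteqP; split => w /= V.
  by move=> k; rewrite /= mem_iota add0n => kn; apply: V; lia.
move=> x xn; have := V `|x|%N; rewrite /= mem_iota add0n.
by rewrite (_ : - `|x|%N%:Z = x); [apply; lia|lia].
Qed.

Let v t n : R := fine (P (vacancy t n)).

Let PvE t n : P (vacancy t n) = (v t n)%:E.
Proof. by rewrite fineK// fin_num_measure//; exact: measurable_vacancy. Qed.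

Let NP x : poisson_process 1 (N x). Proof. by case: proc. Qed.
Let Nind : independent_processes N. Proof. by case: proc. Qed.

(** The first error bounds the probability of two rings in one cell of a box of n + B + 2 sites, the
    second that the right walker passes [B]. Outside these events and a null set, the interval is
    vacant exactly when the walkers have met. *)
Lemma vacancy_approx (t : R) (n M B : nat) : 0 < t -> (0 < M)%N -> (0 < B)%N ->
  `|v t n - pair_law (ring_prob (t / M%:R)) (fun l r => l == r) M (- n%:Z) 0|
    <= (n + B + 2)%:R ^+ 2 * t ^+ 2 / M%:R + t / B%:R.
Proof.
move=> t0 M0 B0; set lam := t / M%:R; set p := ring_prob lam.
set m : R := (n + B + 2)%:R.
have M0' : 0 < M%:R :> R by rewrite ltr0n.
have lam0 : 0 < lam by rewrite divr_gt0.
have lamM : lam * M%:R = t by rewrite /lam divfK ?gt_eqF.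
have [_ _ [Z [mZ PZ ZN]]] := proc.
pose b w i x := rung N lam i x w.
(* The sites from -n to B + 1, the last being the extra site to the right of the walkers needed by
   [vacant_dual]. *)
pose xs := [seq i%:Z - n%:Z | i <- iota 0 (n + B + 2)].
pose bad := bad_grid N lam M xs.
pose far := [set w | (B%:Z < dual (b w) M 0)%R].
pose D := [set w | dual (b w) M (- n%:Z) == dual (b w) M 0].
have mr := measurable_rung N lam.
have mD : measurable D := measurable_dual mr (fun l r => l == r) M (- n%:Z) 0.
have mfar : measurable far := measurable_dual mr (fun _ r => (B%:Z < r)%R) M 0 0.
have mbad : measurable bad := measurable_bad_grid N lam M xs.
have mV := measurable_vacancy t n.
have PD : P D = (pair_law p (fun l r => l == r) M (- n%:Z) 0)%:E.
  by apply: dual_law; [exact: mr|exact: (rung_bernoulli lam0 NP Nind)].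
have Pfar : (P far <= (t / B%:R)%:E)%E.
  have -> : P far = (pair_law p (fun _ r => (B%:Z < r)%R) M 0 0)%:E.
    by apply: (@dual_law _ _ _ _ _ _ mr (rung_bernoulli lam0 NP Nind)
      (fun _ r => (B%:Z < r)%R)).
  rewrite lee_fin; apply: le_trans (pair_law_far_ub (ring_prob01 lam0) M 0 B0) _.
  rewrite add0r ler_wpM2r ?invr_ge0// -lamM mulrC ler_wpM2r// ring_prob_le//.
have Pbad : (P bad <= (m ^+ 2 * t ^+ 2 / M%:R)%:E)%E.
  apply: le_trans (bad_grid_probability lam0 NP Nind M xs) _.
  rewrite lee_fin size_map size_iota -/m /lam le_eqVlt; apply/orP; left.
  by apply/eqP; field; rewrite gt_eqF.
have equiv w : ~ (Z `|` (bad `|` far)) w -> vacancy t n w <-> D w.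
  move=> nw.
  have path : coalescence_path (fun x t => N x t w) fully_packed (fun t x => xi t x w).
    by apply: contrapT => np; apply: nw; left; apply: ZN.
  have nbad : ~ bad w by move=> ?; apply: nw; right; left.
  have nfar : dual (b w) M 0 <= B%:Z.
    by rewrite leNgt; apply/negP => ?; apply: nw; right; right.
  have mono (x : int) (u s : R) : 0 <= u <= s -> (N x u w <= N x s w)%N.
    by have [_ h _ _ _] := NP x; exact: h.
  have rc (x : int) (u : R) : 0 <= u -> \forall s \near u^'+, N x s w = N x u w.
    by have [_ _ h _ _] := NP x; exact: h.
  have inxs (x : int) : - n%:Z <= x <= B%:Z + 1 -> x \in xs.
    move=> xb; apply/mapP; exists (absz (x + n%:Z)).
      by rewrite mem_iota add0n; lia.
    by lia.
  have nbadP (i : nat) (x y : int) : (i < M)%N -> - n%:Z <= x <= B%:Z + 1 ->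
      - n%:Z <= y <= B%:Z + 1 -> ~ bad_pair N lam i x y w.
    by move=> iM xb yb; apply: (not_bad_gridP nbad iM); exact: inxs.
  have l0 : - n%:Z <= 0 :> int by rewrite oppr_le0.
  have := @vacant_dual R (fun x t => N x t w) fully_packed (fun t x => xi t x w)
    mono rc path lam M (B%:Z + 1) lam0 (- n%:Z) 0 M (leqnn M) l0.
  rewrite lamM /vacancy/= => ->.
  (* At time 0 every site is occupied, so vacancy of the dual interval means that it is empty, that
     is, that the walkers coincide. *)
  - have := dual_homo (b w) M l0; rewrite /D/= -/(b w).
    rewrite le_eqVlt => /predU1P[E|lr].
      by rewrite E eqxx; split => // _ x; rewrite ltNge andNb.
    rewrite lt_eqF//; split => //= V.
    have [h _ _] := path.
    have := V (dual (b w) M 0); rewrite lr lexx h => /(_ isT).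
    by [].
  - by rewrite lerD2r.
  - move=> i x iM xb; rewrite leqNgt; apply/negP => H.
    by apply: (nbadP i x x iM xb xb); rewrite /bad_pair eqxx.
  - move=> i x y iM xb yb xy; apply/negP => H.
    by apply: (nbadP i x y iM xb yb); rewrite /bad_pair (negbTE xy).
have le_err (E F : set T) : measurable E -> measurable F ->
    (forall w, ~ (Z `|` (bad `|` far)) w -> E w -> F w) ->
    (P E <= P F + (m ^+ 2 * t ^+ 2 / M%:R + t / B%:R)%:E)%E.
  move=> mE mF EF.
  have mbf : measurable (bad `|` far) by exact: measurableU.
  have mZbf : measurable (Z `|` (bad `|` far)) by exact: measurableU.
  apply: (@le_trans _ _ (P (F `|` (Z `|` (bad `|` far))))).
    apply: le_measure; rewrite ?inE//; first exact: measurableU.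
    move=> w Ew; have [?|/EF] := pselect ((Z `|` (bad `|` far)) w); first by right.
    by move=> /(_ Ew); left.
  apply: (le_trans (measureU2 _ mF mZbf)); apply: leeD2l.
  have U : (P (Z `|` (bad `|` far)) <= P Z + P (bad `|` far))%E.
    exact: measureU2.
  apply: (le_trans U); rewrite PZ add0e.
  by apply: (le_trans (measureU2 _ mbad mfar)); rewrite EFinD; apply: leeD.
have h1 := le_err _ _ mV mD (fun w nw => (equiv w nw).1).
have h2 := le_err _ _ mD mV (fun w nw => (equiv w nw).2).
move: h1 h2; rewrite PvE PD -!EFinD !lee_fin.
by rewrite ler_norml => h1 h2; apply/andP; split; lra.
Qed.

(** The discretization is removed: [B] and then [M] are taken so large that their errors fall below
    an arbitrary [e], while the barriers of the scheme remain. *)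
Lemma vacancy_bounds (t K A : R) (n : nat) : 0 < t -> 1 <= K -> 0 <= A ->
  gauss_tail ((n%:R + A) / Num.sqrt t) - gauss_tail (A / Num.sqrt K)
    - 9 * t * (Num.sqrt K)^-1 ^+ 3 <= v t n /\
  v t n <= gauss_tail (n%:R / Num.sqrt (t + K)) + 9 * t * (Num.sqrt K)^-1 ^+ 3.
Proof.
move=> t0 K1 A0.
have K0 : 0 < K by lra.
have c0 : 0 <= (Num.sqrt K)^-1 ^+ 3 by rewrite exprn_ge0// invr_ge0 sqrtr_ge0.
suff main (e : R) : 0 < e ->
    gauss_tail ((n%:R + A) / Num.sqrt t) - gauss_tail (A / Num.sqrt K)
      - 9 * t * (Num.sqrt K)^-1 ^+ 3 <= v t n + e /\
    v t n <= gauss_tail (n%:R / Num.sqrt (t + K)) + 9 * t * (Num.sqrt K)^-1 ^+ 3 + e.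
  by split; apply/ler_addgt0Pr => e /main[].
move=> e0.
pose B := Num.bound (2 * t / e).
have Bt : 2 * t / e < B%:R by rewrite archi_boundP// divr_ge0 ?mulr_ge0// ltW.
have B0 : (0 < B)%N.
  by rewrite -(ltr0n R); apply: le_lt_trans Bt; rewrite divr_ge0 ?mulr_ge0// ltW.
pose m := (n + B + 2)%:R : R.
(* For [M] above this value, the three terms give in turn lam <= 1, a loss of variance 2 t^2 / M <=
   K, and a two-ring error at most e / 2. *)
pose X := t + 2 * t ^+ 2 / K + 2 * (m ^+ 2 * t ^+ 2) / e.
have X1 : 0 <= 2 * t ^+ 2 / K by rewrite divr_ge0 ?mulr_ge0 ?sqr_ge0// ltW.
have X2 : 0 <= 2 * (m ^+ 2 * t ^+ 2) / e.
  by rewrite divr_ge0 ?mulr_ge0 ?sqr_ge0// ltW.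
pose M := Num.bound X.
have XM : X < M%:R by rewrite archi_boundP// /X; lra.
have M0 : 0 < M%:R :> R by apply: le_lt_trans XM; rewrite /X; lra.
have M0' : (0 < M)%N by rewrite -(ltr0n R).
have := vacancy_approx n t0 M0' B0; rewrite -/m.
set lam := t / M%:R; set p := ring_prob lam.
have lam0 : 0 < lam by rewrite divr_gt0.
have lamM : lam * M%:R = t by rewrite /lam divfK ?gt_eqF.
have lam1 : lam <= 1 by rewrite ler_pdivrMr// mul1r; move: XM; rewrite /X; lra.
have err1 : m ^+ 2 * t ^+ 2 / M%:R <= e / 2.
  have : 2 * (m ^+ 2 * t ^+ 2) / e <= M%:R by move: XM; rewrite /X; lra.
  rewrite ler_pdivrMr// ler_pdivrMr//; lra.
have err2 : t / B%:R <= e / 2.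
  have : 2 * t / e <= B%:R by exact: ltW.
  by rewrite !ler_pdivrMr ?ltr0n//; lra.
pose sigma := p * (1 - p).
have s_ub : M%:R * sigma <= t.
  rewrite -lamM mulrC; apply: ler_wpM2r; first exact: ltW.
  exact: ring_variance_ub.
(* With [s_ub], this places K + M sigma between t and t + K; monotonicity of [gauss_tail] then
   replaces it by the endpoint needed in each bound. *)
have s_lb : t - K <= M%:R * sigma.
  have h : t - 2 * t ^+ 2 / M%:R <= M%:R * sigma.
    have := ler_wpM2l (ltW M0) (ring_variance_lb lam0 lam1).
    apply: le_trans; rewrite /lam le_eqVlt; apply/orP; left; apply/eqP; field.
    by rewrite gt_eqF.
  apply: le_trans h; rewrite lerD2l lerN2.
  have : 2 * t ^+ 2 / K <= M%:R by move: XM; rewrite /X; lra.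
  by rewrite !ler_pdivrMr//; lra.
have s0 : 0 <= M%:R * sigma.
  have /andP[p0 p1] := ring_prob01 lam0.
  apply: mulr_ge0; first exact: ltW.
  have q0 : 0 <= 1 - p by rewrite subr_ge0.
  exact: mulr_ge0.
rewrite ler_norml => /andP[lo up].
have l0 : - n%:Z <= 0 :> int by rewrite oppr_le0.
have nE : (0 - - n%:Z)%:~R = n%:R :> R by rewrite sub0r opprK.
have eps : 9 * (M%:R * sigma) * (Num.sqrt K)^-1 ^+ 3 <= 9 * t * (Num.sqrt K)^-1 ^+ 3.
  by apply: ler_wpM2r => //; apply: ler_wpM2l.
split.
  have := pair_law_meet_lb (ring_prob01 lam0) M K1 A0 l0; rewrite nE -/p -/sigma => H.
  have : gauss_tail ((n%:R + A) / Num.sqrt t) <=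
      gauss_tail ((n%:R + A) / Num.sqrt (K + M%:R * sigma)).
    apply: gauss_tail_nincr; apply: ler_wpM2l; first exact: addr_ge0.
    rewrite lef_pV2 ?posrE ?sqrtr_gt0//; last by lra.
    by rewrite ler_wsqrtr//; lra.
  by lra.
have := pair_law_meet_ub (ring_prob01 lam0) M K1 l0; rewrite nE -/p -/sigma => H.
have : gauss_tail (n%:R / Num.sqrt (K + M%:R * sigma)) <=
    gauss_tail (n%:R / Num.sqrt (t + K)).
  apply: gauss_tail_nincr; apply: ler_wpM2l => //.
  rewrite lef_pV2 ?posrE ?sqrtr_gt0//; [|lra|lra].
  by rewrite ler_wsqrtr//; lra.
by lra.
Qed.

End vacancy.

(** * From vacancy probabilities to distribution functions *)

Lemma rightmost_nonposE (eta : int -> bool) (k : nat) : eta (- k%:Z) ->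
  (forall j, (j < k)%N -> eta (- j%:Z) = false) ->
  rightmost_nonpos eta = - k%:Z.
Proof.
move=> ek e0.
have Pk : is_rightmost_nonpos eta (- k%:Z).
  split; [by rewrite oppr_le0|exact: ek|].
  move=> j /andP[kj j0]; have := e0 (absz j).
  by rewrite (_ : - (absz j)%:Z = j); [apply; lia|lia].
rewrite /rightmost_nonpos; case: xgetP => [j _ /= [j0 j1 j2]|/(_ _ Pk)//].
apply/eqP; rewrite eq_le; apply/andP; split.
  rewrite leNgt; apply/negP => kj.
  by case: Pk => _ _ /(_ j); rewrite kj j0 j1 => /(_ isT).
rewrite leNgt; apply/negP => jk.
suff : eta (- k%:Z) = false by rewrite ek.
by apply: j2; rewrite jk; exact: (oppr_le0 k%:Z).
Qed.

Section limit.
Context d (T : measurableType d) (R : realType) (P : probability T R).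
Variables (N : int -> R -> {RV P >-> nat}) (xi : R -> int -> {RV P >-> bool}).
Hypothesis proc : coalescence_process N fully_packed xi.

Local Notation X t := (rescaled_E0 xi t : {RV P >-> R}).
Local Notation v t n := (fine (P (vacancy xi t n))).

Lemma rightmost_occupied t n w : ~ vacancy xi t n w ->
  exists k : nat, [/\ (k < n)%N,
    rightmost_nonpos (fun x => xi t x w) = - k%:Z & xi t (- k%:Z) w].
Proof.
move=> nV; have [k0 [k0n k0P]] : exists k : nat, (k < n)%N /\ xi t (- k%:Z) w.
  apply: contrapT => nex; apply: nV => x xn; apply/negbTE/negP => xx.
  apply: nex; exists (absz x); split; first by lia.
  by rewrite (_ : - (absz x)%:Z = x)//; lia.
have ex : exists k : nat, xi t (- k%:Z) w by exists k0.
case: (ex_minnP ex) => k kP kmin; exists k.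
split=> //; first exact: leq_ltn_trans (kmin _ k0P) k0n.
apply: rightmost_nonposE => // j jk.
by apply/negbTE/negP => /kmin; rewrite leqNgt jk.
Qed.

(** Here [n] is the least integer above a sqrt t, so an integer k satisfies k / sqrt t <= a exactly
    when k < n. The term in [m] covers the case where no particle is found near 0 and the position
    may be the junk value 0. *)
Lemma cdf_rescaled_E0 (t a : R) (n m : nat) : 0 < t -> (n <= m)%N ->
  a * Num.sqrt t < n%:R -> n%:R <= a * Num.sqrt t + 1 ->
  1 - v t n <= fine (cdf (X t) a) <= 1 - v t n + v t m.
Proof.
move=> t0 nm an na.
have st0 : 0 < Num.sqrt t by rewrite sqrtr_gt0.
have mV k := measurable_vacancy xi t k.
have mX : measurable (X t @^-1` `]-oo, a]).
  by rewrite -[Y in measurable Y]setTI; apply: measurable_funP => //; exact: measurable_itv.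
have XE w k : rightmost_nonpos (fun x => xi t x w) = - k%:Z ->
    rescaled_E0 xi t w = k%:R / Num.sqrt t.
  by move=> E; rewrite /rescaled_E0 E -mulrNz opprK.
have lo : (P (~` vacancy xi t n) <= P (X t @^-1` `]-oo, a]))%E.
  apply: le_measure; rewrite ?inE//; first exact: measurableC.
  move=> w /rightmost_occupied[k [kn kE _]] /=.
  rewrite in_itv/= (XE _ _ kE) ler_pdivrMr//.
  have : k.+1%:R <= n%:R :> R by rewrite ler_nat.
  by rewrite -natr1; lra.
have up : (P (X t @^-1` `]-oo, a]) <= P (~` vacancy xi t n) + P (vacancy xi t m))%E.
  apply: le_trans (measureU2 _ (measurableC (mV n)) (mV m)).
  apply: le_measure; rewrite ?inE//.
    by apply: measurableU => //; exact: measurableC.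
  move=> w /=; rewrite in_itv/= => Xa.
  have [Vm|/rightmost_occupied[k [km kE kP]]] := pselect (vacancy xi t m w).
    by right.
  left=> Vn; move: Xa; rewrite (XE _ _ kE) ler_pdivrMr// => ka.
  have kn : (k < n)%N.
    by rewrite -(ltr_nat R); apply: le_lt_trans an.
  have : xi t (- k%:Z) w = false by apply: Vn; clear -kn; lia.
  by rewrite kP.
have fX : P (X t @^-1` `]-oo, a]) \is a fin_num by exact: fin_num_measure.
have fV k : P (vacancy xi t k) \is a fin_num by exact: fin_num_measure.
move: lo up; rewrite probability_setC// /cdf /distribution /pushforward/=.
rewrite -(fineK fX) -(fineK (fV n)) -(fineK (fV m)) -EFinB -EFinD !lee_fin => lo up.
by apply/andP; split.
Qed.

Lemma sqr1B_mul1D_le1 (eta : R) : 0 <= eta <= 1 -> (1 - eta) ^+ 2 * (1 + eta ^+ 4) <= 1.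
Proof.
move=> /andP[e0 e1].
have h1 : (1 - eta) ^+ 2 <= 1 - eta by nra.
have h2 : eta ^+ 4 <= eta by rewrite exprS ler_piMr// exprn_ile1.
have h3 : 0 <= eta ^+ 4 by exact: exprn_ge0.
by nra.
Qed.

(** The choice K = eta^4 t, A = eta sqrt t gives A / sqrt K = 1 / eta and a scheme error 9 / (eta^6
    sqrt t). By the Lipschitz bound on [gauss_tail], the shift [A] costs eta, the shift [K] costs a
    eta and the rounding of a sqrt t costs 1 / sqrt t; the second eta pays for the junk value. *)
Lemma cdf_bound (t a eta : R) : 0 < eta <= 1 -> 1 <= eta ^+ 4 * t -> 0 <= a ->
  `|fine (cdf (X t) a) - (1 - gauss_tail a)| <=
    (2 + a) * eta + gauss_tail eta^-1 + (1 + 18 / eta ^+ 6) / Num.sqrt t.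
Proof.
move=> /andP[e0 e1] et a0.
have e40 : 0 < eta ^+ 4 by rewrite exprn_gt0.
have t0 : 0 < t by rewrite -(pmulr_rgt0 _ e40); exact: lt_le_trans et.
set r := Num.sqrt t; have r0 : 0 < r by rewrite sqrtr_gt0.
have r2 : r ^+ 2 = t by rewrite sqr_sqrtr// ltW.
pose K := eta ^+ 4 * t.
have sK : Num.sqrt K = eta ^+ 2 * r.
  by rewrite /K -r2 (exprM _ 2 2) -exprMn sqrtr_sqr ger0_norm// mulr_ge0 ?sqr_ge0// ltW.
pose u := 9 / eta ^+ 6 / r.
have err : 9 * t * (Num.sqrt K)^-1 ^+ 3 = u.
  by rewrite /u sK -r2; field; rewrite !gt_eqF.
pose A := eta * r; have A0 : 0 <= A by rewrite mulr_ge0// ltW.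
have AK : A / Num.sqrt K = eta^-1.
  by rewrite sK /A; field; rewrite !gt_eqF.
have ar0 : 0 <= a * r by rewrite mulr_ge0// ltW.
pose n := (Num.truncn (a * r)).+1.
have an : a * r < n%:R by exact: truncnS_gt.
have na : n%:R <= a * r + 1 by rewrite /n -natr1 lerD2r truncn_le.
have [y y0 Gy] := gauss_tail_cvg0 e0.
set q := Num.sqrt (t + K).
have tK : t <= t + K by rewrite lerDl (le_trans ler01).
have q0 : 0 < q by rewrite sqrtr_gt0 (lt_le_trans t0).
(* Large enough for m / q >= y, so that the tail at m / q is at most eta. *)
pose m := maxn n (Num.bound (y * q)).
have ym : y <= m%:R / q.
  rewrite ler_pdivlMr//; apply: (@le_trans _ _ (Num.bound (y * q))%:R).
    by rewrite ltW// archi_boundP// mulr_ge0// ltW.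
  by rewrite ler_nat leq_maxr.
have nm : (n <= m)%N by exact: leq_maxl.
have /andP[c1 c2] := cdf_rescaled_E0 t0 nm an na.
have [n_lo n_up] := vacancy_bounds proc n t0 et A0.
have [_ m_up] := vacancy_bounds proc m t0 et A0.
move: n_lo n_up m_up; rewrite -/K -/r -/q err AK => n_lo n_up m_up.
have Gm : gauss_tail (m%:R / q) <= eta by apply: le_trans Gy; exact: gauss_tail_nincr.
(* Passing from the scale sqrt (t + K) to sqrt t costs a factor 1 - eta, whence n / q >= a (1 -
   eta). *)
have qr : (1 - eta) * q <= r.
  have q2 : q ^+ 2 = t * (1 + eta ^+ 4).
    by rewrite sqr_sqrtr ?(le_trans (ltW t0))// /K; ring.
  rewrite -(@ler_pXn2r _ 2)// ?nnegrE ?mulr_ge0 ?subr_ge0 ?(ltW q0) ?(ltW r0)//.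
  rewrite exprMn q2 r2 mulrCA ler_piMr ?(ltW t0)// sqr1B_mul1D_le1// e1 ltW//.
have nq : a - a * eta <= n%:R / q.
  rewrite ler_pdivlMr//; apply: le_trans (ltW an).
  by rewrite -[Y in Y - _]mulr1 -mulrBr -mulrA ler_wpM2l.
have Gn : gauss_tail (n%:R / q) <= gauss_tail a + a * eta.
  apply: (le_trans (gauss_tail_nincr nq)).
  have aa : a - a * eta <= a by rewrite gerBl mulr_ge0// ltW.
  by apply: (le_trans (gauss_tail_lipschitz aa)); rewrite subKr.
have GnA : gauss_tail a <= gauss_tail ((n%:R + A) / r) + (r^-1 + eta).
  have h : (n%:R + A) / r <= a + (r^-1 + eta).
    rewrite ler_pdivrMr// /A !mulrDl mulVf ?gt_eqF//; lra.
  have aa : a <= a + (r^-1 + eta) by rewrite lerDl addr_ge0 ?invr_ge0// ltW.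
  apply: (le_trans (gauss_tail_lipschitz aa)).
  by rewrite [a + _ - a]addrAC subrr add0r lerD2r; exact: gauss_tail_nincr.
have G0 : 0 <= gauss_tail eta^-1 by rewrite gauss_tail_ge0// invr_ge0 ltW.
have ri0 : 0 <= r^-1 by rewrite invr_ge0 ltW.
have ae0 : 0 <= a * eta by rewrite mulr_ge0// ltW.
have -> : (1 + 18 / eta ^+ 6) / r = r^-1 + 2 * u.
  by rewrite /u; field; rewrite !gt_eqF.
have er0 : 0 <= u by rewrite !divr_ge0 ?exprn_ge0 ?ltW.
have -> : (2 + a) * eta = 2 * eta + a * eta by ring.
move: (fine (cdf _ _)) (v t n) (v t m) (gauss_tail a) (gauss_tail eta^-1)
  (gauss_tail (n%:R / q)) (gauss_tail (m%:R / q)) (gauss_tail ((n%:R + A) / r))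
  r^-1 (a * eta) c1 c2 n_lo n_up m_up Gm Gn GnA G0 ri0 ae0.
move: (u) er0; clear -e0 => *.
by rewrite ler_norml; apply/andP; split; lra.
Qed.

Lemma cvg_cdf_rescaled_E0 (a : R) : 0 <= a ->
  cdf (X t) a @[t --> +oo] --> half_gauss_prob `]-oo, a].
Proof.
move=> a0; rewrite half_gauss_cdf//.
apply: cvg_trans (_ : (fine (cdf (X t) a))%:E @[t --> +oo] --> _).
  apply: near_eq_cvg; apply: nearW => t; rewrite fineK//.
  apply: fin_num_measure; exact: measurable_itv.
apply: cvg_EFin; first exact: nearW.
apply/cvgrPdist_le => e e0.
have e4 : 0 < e / 4 by rewrite divr_gt0.
have [y y0 Gy] := gauss_tail_cvg0 e4.
(* The first entry makes eta <= 1 and 1 / eta >= y, hence a tail at 1 / eta of at most e / 4; the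
   second bounds (2 + a) eta by e / 4. The last term of [cdf_bound] is made small by taking t
   large. *)
pose eta := Num.min (y + 1)^-1 (e / 4 / (2 + a)).
have y1 : 0 < y + 1 by lra.
have a2 : 0 < 2 + a by lra.
have eta0 : 0 < eta by rewrite lt_min invr_gt0 y1 divr_gt0.
have eta1 : eta <= 1 by rewrite ge_min invf_le1// lerDr y0.
have Geta : gauss_tail eta^-1 <= e / 4.
  apply: le_trans Gy; apply: gauss_tail_nincr.
  apply: (@le_trans _ _ (y + 1)); first by rewrite lerDl.
  by rewrite -[leLHS]invrK lef_pV2 ?posrE ?invr_gt0// ge_min lexx.
have aeta : (2 + a) * eta <= e / 4.
  by rewrite -ler_pdivlMl// mulrC ge_min lexx orbT.
pose c := 1 + 18 / eta ^+ 6.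
have c0 : 0 < c by rewrite addr_gt0// divr_gt0// exprn_gt0.
apply: filterS2 (nbhs_pinfty_ge (num_real (eta ^+ 4)^-1))
  (nbhs_pinfty_ge (num_real ((c / (e / 4)) ^+ 2))) => t et' t1.
have et : 1 <= eta ^+ 4 * t by rewrite -ler_pdivrMl ?exprn_gt0// mulr1.
have ct : c / Num.sqrt t <= e / 4.
  have h0 : 0 < c / (e / 4) by rewrite divr_gt0.
  have h : c / (e / 4) <= Num.sqrt t.
    by rewrite -(ger0_norm (ltW h0)) -sqrtr_sqr ler_wsqrtr.
  rewrite ler_pdivrMr; last exact: lt_le_trans h.
  by rewrite mulrC -ler_pdivrMr.
rewrite distrC; have := cdf_bound (introT andP (conj eta0 eta1)) et a0.
move=> /le_trans; apply; rewrite -/c.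
by move: (_ * eta) (gauss_tail _) (c / _) aeta Geta ct => u1 u2 u3 *; lra.
Qed.

End limit.

Theorem corollary6p7 (d : measure_display) (T : measurableType d)
    (R : realType) (P : probability T R)
    (N : int -> R -> {RV P >-> nat}) (xi : R -> int -> {RV P >-> bool}) :
  coalescence_process N fully_packed xi ->
  cvg_in_distribution (fun t : R => rescaled_E0 xi t : {RV P >-> R})
    (@half_gauss_prob R).
Proof.
move=> proc a _; have [a0|a0] := leP 0 a; first exact: (cvg_cdf_rescaled_E0 proc).
(* For a < 0 both distribution functions vanish: the rescaled position is nonnegative, also when it
   takes the junk value 0. *)
rewrite [Y in _ --> Y](_ : _ = 0%E); last exact: half_gauss_cdf_lt0.
suff -> : (fun t : R => cdf (rescaled_E0 xi t : {RV P >-> R}) a) = cst 0%E.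
  exact: cvg_cst.
apply/funext => t; rewrite /cdf /distribution /pushforward/=.
rewrite (_ : _ @^-1` _ = set0) ?measure0//; apply/seteqP; split=> // w /=.
rewrite in_itv/= => Xa; have := le_lt_trans Xa a0; apply/negP; rewrite -leNgt.
rewrite /rescaled_E0 divr_ge0 ?sqrtr_ge0// oppr_ge0 lerz0.
by rewrite /rightmost_nonpos; case: xgetP => // j _ [].
Qed.
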